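(* If the dimension of a coideal subalgebra $I$ of $KD(n)$ divides $2n$ (and not just $4n$), then either its Jones projection $p_I$ dominates $e_1+e_2+e_3+e_4$ and then $I$ is contained in $K_1$, or there exists a unique $i\in\{2,3,4\}$ such that $p_I$ dominates $e_1+e_i$ and $I$ is a coideal subalgebra contained in $K_i$. In particular, if $n$ is a power of $2$, then any coideal subalgebra of $KD(n)$ is contained in one of the $K_i$'s.
   Context: A coideal subalgebra of a finite-dimensional Kac algebra ($C^*$-Hopf algebra) $K$ is a unital $*$-subalgebra $I$ with $\Delta(I)\subset K\otimes I$. Its Jones projection $p_I$ is the unique nonzero projection in $I$ with $yp_I=\varepsilon(y)p_I$ for all $y\in I$. $I(f)$ is the smallest coideal subalgebra containing the projection $f$. A projection $p$ dominates a projection $q$ if $q\le p$. $KD(n)$ ($n\ge1$): let $D_{2n}=\langle a,b\mid a^{2n}=b^2=1,\ ba=a^{-1}b\rangle$ (order $4n$), with canonical basis $\lambda(g)$ of $\mathbb{C}[D_{2n}]$, and $\Delta_s(\lambda(g))=\lambda(g)\otimes\lambda(g)$. Put $h_1=1,h_2=a^n,h_3=b,h_4=ba^n$, $\nu=-1+2\mathrm{i}$, and $\Omega=\sum_{i,j}c_{i,j}\lambda(h_i)\otimes\lambda(h_j)$ with $$(c_{i,j})=\frac18\begin{pmatrix}5&1&1&1\\1&1&\bar\nu&\nu\\1&\nu&1&\bar\nu\\1&\bar\nu&\nu&1\end{pmatrix}.$$ $\Omega$ is unitary. $KD(n)$ is the $*$-algebra $\mathbb{C}[D_{2n}]$ with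 its usual counit and antipode and the coproduct $\Delta(x)=\Omega\Delta_s(x)\Omega^*$. In $KD(n)$: $e_1=\frac1{4n}\sum_{k=0}^{2n-1}(\lambda(a^k)+\lambda(ba^k))$, $e_2=\frac1{4n}\sum_k(\lambda(a^k)-\lambda(ba^k))$, $e_3=\frac1{4n}\sum_k(-1)^k(\lambda(a^k)-\lambda(ba^k))$, $e_4=\frac1{4n}\sum_k(-1)^k(\lambda(a^k)+\lambda(ba^k))$. $K_i=I(e_1+e_i)$ for $i=2,3,4$ (of dimension $2n$), and $K_1=I(e_1+e_2+e_3+e_4)=K_2\cap K_3\cap K_4$ (of dimension $n$).
   Formalization: In the last sentence ''any coideal subalgebra'' is read as any proper one, I ≠ KD(n): KD(n) itself is a coideal subalgebra of dimension 4n, so it lies in no K_i, as these have dimension at most 2n. *)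

(* Defs.v *)
From HB Require Import structures.
From mathcomp Require Import all_boot all_order all_algebra all_fingroup.
From mathcomp Require Import all_solvable falgebra.
From mathcomp Require Import boolp classical_sets reals complex.

Set Implicit Arguments.
Unset Strict Implicit.
Unset Printing Implicit Defensive.

Import GroupScope Order.TTheory GRing.Theory Num.Theory.
Local Open Scope ring_scope.

(* The group algebra C[gT], with convolution product: the element
   \sum_g x g *: lam g is encoded by its coefficient function x. *)
Definition galg (C : fieldType) (gT : finGroupType) : Type := {ffun gT -> C}.

Section GroupAlgebra.
Variables (C : fieldType) (gT : finGroupType).
Local Notation A := (galg C gT).
Implicit Types (x y : A) (g h : gT).

HB.instance Definition _ := Vector.copy A {ffun gT -> C^o}.

Definition lam g : A := [ffun h => (h == g)%:R].

Definition galg_mul x y : A := [ffun g => \sum_h x h * y (h^-1 * g)%g].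

Fact galg_mulA : associative galg_mul.
Proof.
move=> x y z; apply/ffunP=> g; rewrite !ffunE.
under eq_bigr do rewrite ffunE mulr_sumr.
under [RHS]eq_bigr do rewrite ffunE mulr_suml.
rewrite [RHS]exchange_big /=; apply: eq_bigr => h _.
rewrite (reindex_inj (mulgI h^-1%g)) /=; apply: eq_bigr => k _.
by rewrite mulrA invMg invgK -!mulgA mulKVg.
Qed.

Fact galg_mul1l : left_id (lam 1%g) galg_mul.
Proof.
move=> x; apply/ffunP=> g; rewrite ffunE (bigD1 1%g) //= ffunE eqxx mul1r.
rewrite invg1 mul1g big1 ?addr0 // => h /negPf hne.
by rewrite ffunE hne mul0r.
Qed.

Fact galg_mul1r : right_id (lam 1%g) galg_mul.
Proof.
move=> x; apply/ffunP=> g; rewrite ffunE (bigD1 g) //= ffunE mulVg eqxx mulr1.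
rewrite big1 ?addr0 // => h hne.
by rewrite ffunE -eq_mulVg1 (negPf hne) mulr0.
Qed.

Fact galg_mulDl : left_distributive galg_mul +%R.
Proof.
move=> x y z; apply/ffunP=> g; rewrite !ffunE -big_split.
by apply: eq_bigr => h _; rewrite ffunE mulrDl.
Qed.

Fact galg_mulDr : right_distributive galg_mul +%R.
Proof.
move=> x y z; apply/ffunP=> g; rewrite !ffunE -big_split.
by apply: eq_bigr => h _; rewrite ffunE mulrDr.
Qed.

Fact galg_1_neq0 : lam 1%g != 0.
Proof. by apply/eqP=> /ffunP/(_ 1%g)/eqP; rewrite !ffunE eqxx oner_eq0. Qed.

HB.instance Definition _ := GRing.Zmodule_isNzRing.Build A
  galg_mulA galg_mul1l galg_mul1r galg_mulDl galg_mulDr galg_1_neq0.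

Fact galg_scaleAl (c : C) x y : c *: (x * y) = (c *: x) * y.
Proof.
apply/ffunP=> g; rewrite !ffunE /GRing.scale /= mulr_sumr.
by apply: eq_bigr => h _; rewrite ffunE mulrA.
Qed.

Fact galg_scaleAr (c : C) x y : c *: (x * y) = x * (c *: y).
Proof.
apply/ffunP=> g; rewrite !ffunE /GRing.scale /= mulr_sumr.
by apply: eq_bigr => h _; rewrite ffunE mulrCA.
Qed.

HB.instance Definition _ := GRing.Lmodule_isLalgebra.Build C A galg_scaleAl.
HB.instance Definition _ := GRing.Lalgebra_isAlgebra.Build C A galg_scaleAr.
HB.instance Definition _ := Algebra_isFalgebra.Build C A.

End GroupAlgebra.

Section Involution.
Variables (C : numClosedFieldType) (gT : finGroupType).
Local Notation A := (galg C gT).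
Local Notation AA := (galg C (gT * gT)%type).
Implicit Types (x y p q : A) (g h : gT) (I J : {vspace A}).

Definition star (hT : finGroupType) (x : galg C hT) : galg C hT :=
  [ffun g => (x (g^-1)%g)^*].

Definition counit x : C := \sum_g x g.

(* C[G] (x) C[G] is realised as C[G * G]. *)
Definition tens x y : AA := [ffun u => x u.1 * y u.2].

Definition coprod_s x : AA := \sum_g x g *: tens (lam C g) (lam C g).

(* The algebraic tensor product C[G] (x) I. *)
Definition in_tens I (z : AA) : Prop :=
  exists2 s : seq (A * A), {in s, forall u, u.2 \in I}
    & z = \sum_(u <- s) tens u.1 u.2.

Definition projection p : Prop := p * p = p /\ star p = p.

(* The order of the C*-algebra: q <= p iff p - q is positive. *)
Definition dominates p q : Prop := exists z : A, p - q = star z * z.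

Definition jones_spec I p : Prop :=
  [/\ projection p, p != 0, p \in I &
      {in I, forall y, y * p = counit y *: p}].

Definition jones_proj I : A := xget 0 (jones_spec I).

Section Coideals.
Variable Delta : A -> AA.

Definition coideal_subalgebra I : Prop :=
  [/\ 1 \in I, {in I &, forall x y, x * y \in I},
      {in I, forall x, star x \in I} &
      {in I, forall x, in_tens I (Delta x)}].

Definition smallest_coideal f I : Prop :=
  [/\ coideal_subalgebra I, f \in I &
      forall J, coideal_subalgebra J -> f \in J -> (I <= J)%VS].

Definition coideal_gen f : {vspace A} := xget 0%VS (smallest_coideal f).

End Coideals.

Lemma counitM x y : counit (x * y) = counit x * counit y.
Proof.
rewrite /counit mulr_suml.
under eq_bigr do rewrite ffunE.
rewrite exchange_big; apply: eq_bigr => h _; rewrite -mulr_sumr.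
by congr (_ * _); rewrite (reindex_inj (mulgI h)); apply: eq_bigr => k _; rewrite mulKg.
Qed.

Lemma counit1 : counit 1 = 1.
Proof.
rewrite /counit (bigD1 1%g) //= ffunE eqxx big1 ?addr0 // => h /negPf hne.
by rewrite ffunE hne.
Qed.

Lemma counitD x y : counit (x + y) = counit x + counit y.
Proof. by rewrite /counit -big_split; apply: eq_bigr => h _; rewrite ffunE. Qed.

Lemma counitZ c x : counit (c *: x) = c * counit x.
Proof. by rewrite /counit mulr_sumr; apply: eq_bigr => h _; rewrite ffunE. Qed.

Lemma counit_star x : counit (star x) = (counit x)^*.
Proof.
rewrite /counit rmorph_sum (reindex_inj invg_inj); apply: eq_bigr => h _.
by rewrite ffunE invgK.
Qed.

Lemma starK x : star (star x) = x.
Proof. by apply/ffunP=> g; rewrite !ffunE invgK conjCK. Qed.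

Lemma starM x y : star (x * y) = star y * star x.
Proof.
apply/ffunP=> g; rewrite !ffunE rmorph_sum (reindex_inj (mulgI g^-1%g)).
apply: eq_bigr => h _; rewrite !ffunE rmorphM mulrC; congr (_ * _).
- by rewrite invMg invgK mulgK.
- by rewrite invMg invgK.
Qed.

Lemma star_mul_eq0 x : (star x * x) 1%g = 0 -> x = 0.
Proof.
rewrite ffunE => x0.
have {}x0 : \sum_g `|x g| ^+ 2 = 0.
  rewrite -[RHS]x0 [RHS](reindex_inj invg_inj); apply: eq_bigr => g _.
  by rewrite ffunE mulg1 invgK normCK mulrC.
apply/ffunP=> g; rewrite ffunE; apply/eqP; rewrite -normr_eq0 -sqrf_eq0.
by move/psumr_eq0P: x0 => -> // h _; rewrite exprn_ge0.
Qed.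

Lemma in_tensP I z :
  in_tens I z <-> forall g, ([ffun h => z (g, h)] : A) \in I.
Proof.
split=> [[s sI ->] g | zI].
  rewrite (_ : [ffun _ => _] = \sum_(u <- s) u.1 g *: u.2).
    by rewrite big_seq; apply: memv_suml => u /sI uI; rewrite memvZ.
  apply/ffunP=> h; rewrite ffunE !sum_ffunE; apply: eq_bigr => u _.
  by rewrite !ffunE.
exists [seq (lam C g, [ffun h => z (g, h)] : A) | g <- enum gT].
  by move=> u /mapP[g _ ->]; apply: zI.
rewrite big_map big_enum /=; apply/ffunP=> -[g h].
rewrite sum_ffunE (bigD1 g) //= !ffunE eqxx mul1r big1 ?addr0 // => k kne.
by rewrite !ffunE eq_sym (negPf kne) mul0r.
Qed.

Lemma jones_specP I :
    1 \in I -> {in I &, forall x y, x * y \in I} ->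
    {in I, forall x, star x \in I} ->
  jones_spec I (jones_proj I) /\ (forall p, jones_spec I p -> p = jones_proj I).
Proof.
move=> I1 IM IS.
have jcounit p : jones_spec I p -> counit p = 1.
  move=> [[pp _] p0 pI pE]; move: (pE p pI); rewrite pp => /eqP.
  rewrite -{1}[p]scale1r -subr_eq0 -scalerBl scaler_eq0 (negPf p0) orbF.
  by rewrite subr_eq0 => /eqP.
have juniq p q : jones_spec I p -> jones_spec I q -> p = q.
  move=> jp jq; move: (jcounit _ jp) (jcounit _ jq).
  case: jp jq => [[_ ps] _ pI pE] [[_ qs] _ qI qE] p1 q1.
  move: (pE q qI) (qE p pI); rewrite p1 q1 !scale1r => qp pq.
  by rewrite -ps -qp starM ps qs.
suff [p jp] : exists p, jones_spec I p.
  split; first exact: (@xgetI _ 0 (jones_spec I) p jp).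
  by move=> q jq; apply: juniq jq _; apply: (@xgetI _ 0 (jones_spec I) p jp).
have counit_lin : linear (counit : A -> C^o).
  by move=> c x y; rewrite counitD counitZ.
pose cm := GRing.isLinear.Build C A C^o _ counit counit_lin.
pose cl : {linear A -> C^o} := HB.pack (counit : A -> C^o) cm.
pose J := (I :&: lker (linfun cl))%VS.
have JE y : (y \in J) = (y \in I) && (counit y == 0).
  by rewrite memv_cap memv_ker lfunE.
pose phi (z : A) : 'rV[C]_(\dim J) := \row_i ((vbasis J)`_i * z) 1%g.
have phi_lin : linear phi.
  move=> c x y; apply/rowP=> i; rewrite !mxE mulrDr -scalerAr.
  by rewrite [LHS]ffunE ffunE.
pose pm := GRing.isLinear.Build C A _ _ phi phi_lin.
pose pl : {linear A -> 'rV[C]_(\dim J)} := HB.pack phi pm.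
have [z zI z0] : exists2 z, z \in (I :&: lker (linfun pl))%VS & z != 0.
  have : (0 < \dim (I :&: lker (linfun pl)))%N.
    have := limg_ker_dim (linfun pl) I.
    have lt1 : (\dim (linfun pl @: I) <= \dim J)%N.
      by rewrite (leq_trans (dimvS (subvf _))) // dimvf /dim /= mul1n.
    have lt2 : (\dim J < \dim I)%N.
      rewrite ltn_neqAle dimvS ?capvSl // andbT; apply/negP.
      move=> dimE.
      have /eqP JI : J == I by rewrite eqEdim capvSl (eqP dimE) leqnn.
      by move: I1; rewrite -JI JE counit1 oner_eq0 andbF.
    move=> dimE; rewrite lt0n; apply/eqP=> d0.
    by move: lt2; rewrite -dimE d0 add0n ltnNge lt1.
  rewrite lt0n dimv_eq0 => nz; exists (vpick (I :&: lker (linfun pl))%VS).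
    exact: memv_pick.
  by rewrite vpick0.
move: zI; rewrite memv_cap memv_ker lfunE => /andP[zI /eqP/rowP phi0].
have tau0 y : y \in J -> (y * z) 1%g = 0.
  move=> yJ; rewrite (coord_vbasis yJ) mulr_suml sum_ffunE big1 // => i _.
  rewrite -scalerAl ffunE; move: (phi0 i); rewrite !mxE => ->.
  by rewrite scaler0.
have Jz y : y \in J -> y * z = 0.
  move=> yJ; have /andP[yI y0] : (y \in I) && (counit y == 0) by rewrite -JE.
  apply: star_mul_eq0; set w := y * z; have wI : w \in I by apply: IM.
  by rewrite /w mulrA tau0 // JE !IM ?IS //= counitM (eqP y0) mulr0.
have zE y : y \in I -> y * z = counit y *: z.
  move=> yI; apply/eqP; rewrite -subr_eq0 -[X in _ - X]mul1r -scalerAr scalerAl.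
  rewrite -mulrBl; apply/eqP/Jz; rewrite JE memvB ?memvZ //=.
  by rewrite -scaleN1r counitD !counitZ counit1 mulr1 mulN1r subrr.
have e0 : counit z != 0.
  apply/eqP=> cz; move: z0; rewrite (star_mul_eq0 (x := z)) ?eqxx //.
  by rewrite Jz ?ffunE // JE IS //= counit_star cz conjC0.
pose p := (counit z)^-1 *: z.
have pI : p \in I by rewrite memvZ.
have cp : counit p = 1 by rewrite counitZ mulVf.
have pE y : y \in I -> y * p = counit y *: p.
  by move=> yI; rewrite -scalerAr zE // !scalerA mulrC.
have sp : star p * p = p by rewrite pE ?IS // counit_star cp conjC1 scale1r.
exists p; split=> //.
- split; first by rewrite pE // cp scale1r.
  by rewrite -{1}sp starM starK.
- by rewrite scaler_eq0 invr_eq0 (negPf e0).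
Qed.

Lemma coideal_genP Delta f : smallest_coideal Delta f (coideal_gen Delta f).
Proof.
suff [I HI] : exists I, smallest_coideal Delta f I.
  exact: (@xgetI _ 0%VS (smallest_coideal Delta f) I HI).
have [m lem] := ubnP (\dim (fullv : {vspace A})).
have: coideal_subalgebra Delta fullv.
  split=> [|x y _ _|x _|x _]; rewrite ?memvf //.
  by apply/in_tensP => g; rewrite memvf.
have: f \in (fullv : {vspace A}) by rewrite memvf.
elim: m fullv lem => // m IH I lem fI cI.
have [[J [cJ fJ nIJ]]|min] :=
  pselect (exists J, [/\ coideal_subalgebra Delta J, f \in J & ~~ (I <= J)%VS]).
  apply: (IH (I :&: J)%VS); rewrite ?memv_cap ?fI //.
    rewrite (leq_trans _ (lem : \dim I <= m)%N) // ltn_neqAle dimvS ?capvSl //.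
    rewrite andbT; apply: contra nIJ => /eqP dimE.
    by rewrite (sameP capv_idPl eqP) eqEdim capvSl dimE leqnn.
  case: cI cJ => I1 IM IS ID [J1 JM JS JD]; split.
  - by rewrite memv_cap I1.
  - move=> x y; rewrite !memv_cap => /andP[xI xJ] /andP[yI yJ].
    by rewrite IM ?JM.
  - by move=> x; rewrite !memv_cap => /andP[xI xJ]; rewrite IS ?JS.
  - move=> x; rewrite !memv_cap => /andP[xI xJ]; apply/in_tensP => g.
    rewrite memv_cap; apply/andP.
    by split; apply: (proj1 (in_tensP _ _)); [apply: ID|apply: JD].
exists I; split=> // J cJ fJ; apply/negPn/negP => nIJ.
by apply: min; exists J.
Qed.

End Involution.

Section KD.
Variables (C : numClosedFieldType) (n : nat).
Local Notation D := ('D_(4 * n)%N)%type.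

Definition KD : Type := galg C D.
HB.instance Definition _ := Falgebra.copy KD (galg C D).

(* As #|'D_(4 * n)| = 4 * n, this says that a, b are generators in the
   presentation <a, b | a^2n = b^2 = 1, b a = a^-1 b>. *)
Definition dihedral_gens (a b : D) : Prop :=
  [/\ (a ^+ (2 * n)%N = 1)%g, (b ^+ 2 = 1)%g, (b * a = a^-1 * b)%g
    & <<[set a; b]>>%g = [set: D]].

Lemma dihedral_gens_exist : (0 < n)%N -> exists a b : D, dihedral_gens a b.
Proof.
move=> n0.
have q1 : (1 < 2 * n)%N by rewrite (leq_mul (leqnn 2) n0).
have mE : (4 * n = (2 * n).*2)%N by rewrite -muln2 mulnAC.
have := Grp_dihedral q1 [set: D]%G; rewrite -mE homg_refl => /esym.
case/existsP=> -[a b] /=; rewrite !xpair_eqE => /and4P[/eqP gen /eqP a1 /eqP b1].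
rewrite conjgE => /eqP ab; exists a, b; split=> //.
  have bV : (b^-1 = b)%g by apply/eqP; rewrite eq_invg_mul -expg2 b1.
  by rewrite -ab bV -!mulgA -expg2 b1 mulg1.
by rewrite -gen joing_idl joing_idr.
Qed.

Variables a b : D.

Definition KD_h (i : 'I_4) : D := nth 1%g [:: 1; a ^+ n; b; b * a ^+ n]%g i.

Definition KD_nu : C := -1 + 2 * 'i.

Definition KD_c (i j : 'I_4) : C :=
  let nu := KD_nu in
  8^-1 * nth 0 (nth [::] [:: [:: 5; 1;    1;    1   ];
                             [:: 1; 1;    nu^*; nu  ];
                             [:: 1; nu;   1;    nu^*];
                             [:: 1; nu^*; nu;   1   ]] i) j.

Definition KD_Omega : galg C (D * D)%type :=
  \sum_i \sum_j KD_c i j *: tens (lam C (KD_h i)) (lam C (KD_h j)).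

Definition KD_coprod (x : KD) : galg C (D * D)%type :=
  KD_Omega * coprod_s x * star KD_Omega.

Definition KD_e (i : nat) : KD :=
  (4 * n)%N%:R^-1 *: \sum_(k < (2 * n)%N)
    match i with
    | 1 => lam C (a ^+ k)%g + lam C (b * a ^+ k)%g
    | 2 => lam C (a ^+ k)%g - lam C (b * a ^+ k)%g
    | 3 => (-1) ^+ k *: (lam C (a ^+ k)%g - lam C (b * a ^+ k)%g)
    | 4 => (-1) ^+ k *: (lam C (a ^+ k)%g + lam C (b * a ^+ k)%g)
    | _ => 0
    end.

Definition KD_K (i : nat) : {vspace KD} :=
  coideal_gen KD_coprod
    (if i == 1%N then KD_e 1 + KD_e 2 + KD_e 3 + KD_e 4 else KD_e 1 + KD_e i).

End KD.

(* Main.v *)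
Require Import Defs.
From HB Require Import structures.
From mathcomp Require Import all_boot all_order all_algebra all_fingroup.
From mathcomp Require Import all_solvable falgebra.
From mathcomp Require Import reals complex.
From mathcomp Require Import ring zify.
Import Order.TTheory GRing.Theory Num.Theory.
Local Open Scope ring_scope.

Set Implicit Arguments.
Unset Strict Implicit.
Unset Printing Implicit Defensive.

(** Let [p] be the Jones projection of a coideal subalgebra [I] and [h] the
    Haar state of [KD(n)], which is the coefficient at the unit of the group.

    The coproduct of [p] determines [I]: for [x] in [I] one has
    [(1 (x) x) Delta p = (S x (x) 1) Delta p], whence
    [(id (x) h(x .)) Delta p = h(p) S x] ([slice_haar_coproduct]). Evaluating
    this on dual bases gives [h(p) \dim I = 1] ([haar_jones_dim]), and
    applying it to two coideal subalgebras shows that a larger Jones projection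
    belongs to a smaller subalgebra ([jones_proj_mul_subv]). As a projection [f]
    with [eps(f) = 1] lies above the Jones projection of the coideal subalgebra
    [I(f)] that it generates, [I] is contained in [I(f)] as soon as [f <= p]
    ([subv_coideal_gen]). The inclusions of the theorem are thus reduced to
    finding which of the [e_i] lie below [p].

    This is a parity argument. The rank of [p] in the regular representation is
    [4n h(p) = 4n / \dim I]; hence [\dim I] divides [4n], and the rank is even
    when [\dim I] divides [2n]. On the other hand every irreducible
    representation of the dihedral group other than the four characters has
    dimension [2], so that the rank of [p] has the parity of the number of
    characters [chi_i] with [chi_i(p) = 1] ([haar_idempotent_mod2]), that is,
    of the number of [e_i] below [p]. One of them is [e_1], because
    [eps(p) = 1]; so either exactly one or all of [e_2], [e_3], [e_4] lie below
    [p].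

    That [KD(n)] satisfies the identities used in the first part
    ([KD_coprod_kac]) comes down to properties of the coefficients [c_ij], once
    these are indexed by the Klein group: unitarity, row sums, and the symmetry
    [conj c_(u, v) = c_(u + v, v)], which embodies the 2-cocycle identity. *)

(** * Group algebras and their Haar state *)

Section GroupAlgebra.
Variables (C : numClosedFieldType) (gT : finGroupType).
Local Notation A := (galg C gT).
Implicit Types (x y : A) (g h : gT).

Lemma galg_sumE (I : Type) (r : seq I) (P : pred I) (F : I -> A) g :
  (\sum_(i <- r | P i) F i) g = \sum_(i <- r | P i) F i g.
Proof. exact: sum_ffunE. Qed.

Lemma galgZE (c : C) x g : (c *: x) g = c * x g.
Proof. by rewrite ffunE. Qed.

Lemma lamE g h : lam C g h = (h == g)%:R.
Proof. by rewrite ffunE. Qed.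

Lemma galg_lam_sum x : x = \sum_g x g *: lam C g.
Proof.
apply/ffunP=> h; rewrite galg_sumE (bigD1 h) //= galgZE lamE eqxx mulr1.
rewrite big1 ?addr0 // => g ng; rewrite galgZE lamE eq_sym (negPf ng).
exact: mulr0.
Qed.

Lemma lam_mulE g x h : (lam C g * x) h = x (g^-1 * h)%g.
Proof.
rewrite ffunE (bigD1 g) //= lamE eqxx mul1r big1 ?addr0 // => k nk.
by rewrite lamE (negPf nk) mul0r.
Qed.

Lemma mul_lamE g x h : (x * lam C g) h = x (h * g^-1)%g.
Proof.
rewrite ffunE (bigD1 (h * g^-1)%g) //= lamE invMg invgK mulgKV eqxx mulr1.
rewrite big1 ?addr0 // => k nk; rewrite lamE (_ : _ == _ = false) ?mulr0 //.
by apply: contraNF nk => /eqP <-; rewrite invMg invgK mulKVg.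
Qed.

Lemma lamM g h : lam C g * lam C h = lam C (g * h)%g.
Proof.
apply/ffunP=> k.
by rewrite lam_mulE !lamE -(inj_eq (mulgI g)) mulKVg.
Qed.

Lemma star_lam g : star (lam C g) = lam C (g^-1)%g.
Proof.
apply/ffunP=> h; rewrite [LHS]ffunE !lamE conjC_nat.
by rewrite -(inj_eq invg_inj) invgK.
Qed.

Lemma starD x y : star (x + y) = star x + star y.
Proof. by apply/ffunP=> g; rewrite !ffunE rmorphD. Qed.

Lemma starZ (c : C) x : star (c *: x) = c^* *: star x.
Proof. by apply/ffunP=> g; rewrite ffunE !galgZE rmorphM ffunE. Qed.

Lemma star_sum (I : Type) (r : seq I) (P : pred I) (F : I -> A) :
  star (\sum_(i <- r | P i) F i) = \sum_(i <- r | P i) star (F i).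
Proof.
apply: (big_morph _ starD); apply/ffunP=> g; rewrite !ffunE; exact: conjC0.
Qed.

Fact counit_is_scalar : scalar (@counit C gT).
Proof. by move=> c x y; rewrite counitD counitZ. Qed.
HB.instance Definition _ :=
  GRing.isLinear.Build C A C *%R (@counit C gT) counit_is_scalar.

Lemma counit_lam g : counit (lam C g) = 1.
Proof.
rewrite /counit (bigD1 g) //= lamE eqxx big1 ?addr0 // => h nh.
by rewrite lamE (negPf nh).
Qed.

(** The trace [haar 1] is the Haar state of every coproduct considered below;
    since it is faithful on *-subalgebras, the functionals [haar y] are all the
    functionals of such a subalgebra. *)
Definition haar (y x : A) : C := (y * x) 1%g.

Fact haar_is_scalar y : scalar (haar y).
Proof. by move=> c x z; rewrite /haar mulrDr -scalerAr ffunE galgZE. Qed.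
HB.instance Definition _ y :=
  GRing.isLinear.Build C A C *%R (haar y) (haar_is_scalar y).

Lemma haar1E x : haar 1 x = x 1%g.
Proof. by rewrite /haar mul1r. Qed.

Definition antipode (x : A) : A := [ffun g => x (g^-1)%g].

Fact antipode_is_linear : linear antipode.
Proof. by move=> c x y; apply/ffunP=> g; rewrite !ffunE. Qed.
HB.instance Definition _ :=
  GRing.isLinear.Build C A A *:%R antipode antipode_is_linear.

Lemma antipodeK : involutive antipode.
Proof. by move=> x; apply/ffunP=> g; rewrite !ffunE invgK. Qed.

Lemma antipode_lam g : antipode (lam C g) = lam C (g^-1)%g.
Proof. by apply/ffunP=> h; rewrite ffunE !lamE -(inj_eq invg_inj) invgK. Qed.

(** Riesz representation: the form [haar y w] is nondegenerate on [I], as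
    [haar y (star y)] vanishes only for [y = 0]. *)
Lemma haar_representation (I : {vspace A}) (phi : {scalar A}) :
    {in I, forall x, star x \in I} ->
  exists2 y, y \in I & {in I, forall w, phi w = haar y w}.
Proof.
move=> IS; pose psi (y : A) : 'rV[C]_(\dim I) := \row_i haar y (vbasis I)`_i.
have psi_lin : linear psi.
  by move=> c x y; apply/rowP=> i; rewrite !mxE /haar mulrDl -scalerAl ffunE galgZE.
pose pm := GRing.isLinear.Build C A _ _ psi psi_lin.
pose pl : {linear A -> 'rV[C]_(\dim I)} := HB.pack psi pm.
have psiE y w : w \in I -> haar y w = \sum_i coord (vbasis I) i w * psi y 0 i.
  move=> wI; rewrite {1}(coord_vbasis wI) linear_sum; apply: eq_bigr => i _.
  by rewrite linearZ mxE.
have ker0 : (I :&: lker (linfun pl) = 0)%VS.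
  apply/eqP; rewrite -subv0; apply/subvP=> y.
  rewrite memv_cap memv_ker lfunE => /andP[yI /eqP/= y0]; rewrite memv0.
  rewrite -[y]starK (star_mul_eq0 (x := star y)); last first.
    rewrite starK -/(haar _ _) psiE ?IS // big1 // => i _.
    by rewrite y0 mxE mulr0.
  by apply/eqP/ffunP=> g; rewrite !ffunE conjC0.
have full : (linfun pl @: I)%VS = fullv.
  apply/eqP; rewrite eqEdim subvf dimvf /dim /= mul1n.
  by have := limg_ker_dim (linfun pl) I; rewrite ker0 dimv0 add0n => ->.
have : \row_i phi (vbasis I)`_i \in (linfun pl @: I)%VS by rewrite full memvf.
case/memv_imgP=> y yI; rewrite lfunE /= => /rowP yE; exists y => // w wI.
rewrite psiE // {1}(coord_vbasis wI) linear_sum; apply: eq_bigr => i _.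
by rewrite linearZ -yE mxE.
Qed.

Lemma antipodeE x : antipode x = \sum_g x g *: lam C g^-1%g.
Proof.
rewrite {1}[x]galg_lam_sum linear_sum; apply: eq_bigr => g _.
by rewrite linearZ /= antipode_lam.
Qed.

End GroupAlgebra.

(** * Slices of the tensor square *)

Section Slices.
Variables (C : numClosedFieldType) (gT : finGroupType).
Local Notation A := (galg C gT).
Local Notation AA := (galg C (gT * gT)%type).
Implicit Types (x y u v : A) (z : AA) (g h : gT).

Definition row_of (z : AA) g : A := [ffun h => z (g, h)].

Definition slice (phi : A -> C) z : A := [ffun g => phi (row_of z g)].

Fact slice_is_linear (phi : {scalar A}) : linear (slice phi).
Proof.
move=> c z1 z2; apply/ffunP=> g; rewrite ffunE.
have -> : row_of (c *: z1 + z2) g = c *: row_of z1 g + row_of z2 g.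
  by apply/ffunP=> h; rewrite !ffunE.
by rewrite linearP !ffunE.
Qed.
HB.instance Definition _ (phi : {scalar A}) :=
  GRing.isLinear.Build C AA A *:%R (slice phi) (slice_is_linear phi).

Lemma slice_tens (phi : {scalar A}) x y : slice phi (tens x y) = phi y *: x.
Proof.
apply/ffunP=> g; rewrite ffunE galgZE.
have -> : row_of (tens x y) g = x g *: y by apply/ffunP=> h; rewrite !ffunE.
by rewrite linearZ mulrC.
Qed.

Lemma tensM x y u v : tens x y * tens u v = tens (x * u) (y * v).
Proof.
apply/ffunP=> -[g h]; rewrite !ffunE /= mulr_suml.
under [RHS]eq_bigr do rewrite mulr_sumr.
by rewrite pair_big; apply: eq_bigr => -[k l] _; rewrite !ffunE /= mulrACA.
Qed.

Lemma tens_lam g h : tens (lam C g) (lam C h) = lam C (g, h).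
Proof. by apply/ffunP=> -[k l]; rewrite !ffunE -natrM mulnb -xpair_eqE. Qed.

Lemma tens11 : tens 1 1 = 1 :> AA.
Proof. exact: tens_lam. Qed.

Lemma tens_is_linear x : linear (tens x).
Proof.
by move=> c u v; apply/ffunP=> g; rewrite !ffunE mulrDr /GRing.scale /= mulrCA.
Qed.
HB.instance Definition _ x :=
  GRing.isLinear.Build C A AA *:%R (tens x) (tens_is_linear x).

Lemma tens_suml (I : Type) (r : seq I) (P : pred I) (F : I -> C) (G : I -> A) y :
  tens (\sum_(i <- r | P i) F i *: G i) y =
  \sum_(i <- r | P i) F i *: tens (G i) y.
Proof.
apply/ffunP=> -[g h]; rewrite ffunE /= !galg_sumE mulr_suml.
by apply: eq_bigr => i _; rewrite !galgZE [tens _ _ _]ffunE mulrA.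
Qed.

(** Both legs of a tensor are module maps: [slice] commutes with left
    multiplication on the first leg and absorbs it on the second. *)
Lemma slice_mull (phi : {scalar A}) u z :
  slice phi (tens u 1 * z) = u * slice phi z.
Proof.
rewrite [z]galg_lam_sum mulr_sumr !linear_sum mulr_sumr /=.
apply: eq_bigr => -[g h] _; rewrite -scalerAr !linearZ /= -scalerAr.
by rewrite -tens_lam tensM !slice_tens mul1r -scalerAr.
Qed.

Lemma slice_haar_mull x z : slice (haar 1) (tens 1 x * z) = slice (haar x) z.
Proof.
rewrite [z]galg_lam_sum mulr_sumr !linear_sum /=.
apply: eq_bigr => -[g h] _; rewrite -scalerAr !linearZ /=.
by rewrite -tens_lam tensM !slice_tens mul1r /= haar1E.
Qed.

Lemma slice_counitM : {morph slice (@counit C gT) : z1 z2 / z1 * z2}.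
Proof.
move=> z1 z2; rewrite [z1]galg_lam_sum mulr_suml !linear_sum mulr_suml /=.
apply: eq_bigr => -[g h] _; rewrite -scalerAl !linearZ /= -scalerAl.
congr (_ *: _); rewrite [z2]galg_lam_sum mulr_sumr !linear_sum mulr_sumr /=.
apply: eq_bigr => -[k l] _; rewrite -scalerAr !linearZ /= -scalerAr.
by rewrite -!tens_lam tensM !slice_tens /= counitM !counit_lam mulr1 !scale1r.
Qed.

Lemma eq_slice (phi psi : {scalar A}) (I : {vspace A}) z :
  in_tens I z -> {in I, phi =1 psi} -> slice phi z = slice psi z.
Proof.
by move=> /in_tensP zI pE; apply/ffunP=> g; rewrite !ffunE; apply: pE; apply: zI.
Qed.

Fact coprod_s_is_linear : linear (@coprod_s C gT : A -> AA).
Proof.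
move=> c x y; rewrite /coprod_s scaler_sumr -big_split /=.
by apply: eq_bigr => g _; rewrite ffunE galgZE scalerDl scalerA.
Qed.
HB.instance Definition _ :=
  GRing.isLinear.Build C A AA *:%R (@coprod_s C gT) coprod_s_is_linear.

Lemma coprod_s_lam g : coprod_s (lam C g) = lam C (g, g).
Proof.
rewrite /coprod_s (bigD1 g) //= lamE eqxx scale1r big1 ?addr0 ?tens_lam //.
by move=> k nk; rewrite lamE (negPf nk) scale0r.
Qed.

Lemma coprod_sM : {morph @coprod_s C gT : x y / x * y}.
Proof.
move=> x y; rewrite [x]galg_lam_sum mulr_suml !linear_sum mulr_suml /=.
apply: eq_bigr => g _; rewrite -scalerAl !linearZ /= -scalerAl; congr (_ *: _).
rewrite [y]galg_lam_sum mulr_sumr !linear_sum mulr_sumr /=.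
apply: eq_bigr => k _; rewrite -scalerAr !linearZ /= -scalerAr; congr (_ *: _).
by rewrite lamM !coprod_s_lam lamM.
Qed.

End Slices.

(** * Coideal subalgebras and Jones projections *)

Section KacCoproduct.
Variables (C : numClosedFieldType) (gT : finGroupType).
Local Notation A := (galg C gT).
Local Notation AA := (galg C (gT * gT)%type).
Implicit Types (x y p q : A) (z : AA) (g : gT) (I J : {vspace A}).

(** [u (x) v |-> (S u (x) 1) * Delta v]; composed with [Delta], this is how
    coassociativity and the antipode axiom enter the theory. *)
Definition antipode_fold (Delta : A -> AA) z : AA :=
  \sum_u z u *: (tens (lam C u.1^-1%g) 1 * Delta (lam C u.2)).

(** In Sweedler notation the last two axioms read
    [S x1 x2 (x) x3 = 1 (x) x] and [x1 h(x2) = h(x) 1]: these consequences of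
    the Kac algebra axioms are what links a coideal subalgebra to the coproduct
    of its Jones projection. *)
Record kac_coproduct (Delta : A -> AA) : Prop := KacCoproduct {
  kac_linear : linear Delta;
  kac_mul : {morph Delta : x y / x * y};
  kac_counit : forall x, slice (@counit C gT) (Delta x) = x;
  kac_antipode : forall x, antipode_fold Delta (Delta x) = tens 1 x;
  kac_haar : forall x, slice (haar 1) (Delta x) = x 1%g *: 1 }.

Lemma antipode_fold_is_linear (Delta : A -> AA) : linear (antipode_fold Delta).
Proof.
move=> c z1 z2; rewrite /antipode_fold scaler_sumr -big_split /=.
by apply: eq_bigr => u _; rewrite ffunE galgZE scalerDl scalerA.
Qed.
HB.instance Definition _ (Delta : A -> AA) :=
  GRing.isLinear.Build C AA AA *:%R (antipode_fold Delta)
    (antipode_fold_is_linear Delta).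

Lemma antipode_fold_lam (Delta : A -> AA) g k :
  antipode_fold Delta (lam C (g, k)) = lam C (g^-1, 1)%g * Delta (lam C k).
Proof.
rewrite /antipode_fold (bigD1 (g, k)) //= lamE eqxx scale1r tens_lam.
by rewrite big1 ?addr0 // => u nu; rewrite lamE (negPf nu) scale0r.
Qed.

Variables (Delta : A -> AA) (DeltaK : kac_coproduct Delta).

HB.instance Definition _ :=
  GRing.isLinear.Build C A AA *:%R Delta (kac_linear DeltaK).

Lemma antipode_fold_tens x y :
  antipode_fold Delta (tens x y) = tens (antipode x) 1 * Delta y.
Proof.
rewrite antipodeE {2}[y]galg_lam_sum tens_suml mulr_suml linear_sum /=.
under [RHS]eq_bigr do rewrite mulr_sumr.
rewrite pair_big; apply: eq_bigr => -[g h] _ /=.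
by rewrite ffunE linearZ -scalerAr -scalerAl scalerA mulrC.
Qed.

(** With [1 (x) x = S x1 x2 (x) x3] and [Delta (x3 q) = eps(x3) Delta q], the
    element [(1 (x) x) Delta q] equals [(S x (x) 1) Delta q]; the Haar
    state of the second leg then recovers [x]. *)
Lemma slice_haar_coproduct I q x :
    {in I, forall y, y * q = counit y *: q} -> in_tens I (Delta x) ->
  slice (haar x) (Delta q) = q 1%g *: antipode x.
Proof.
move=> qE [s sI DE]; rewrite -slice_haar_mull -(kac_antipode DeltaK) DE.
rewrite linear_sum mulr_suml linear_sum /= -[x in antipode x](kac_counit DeltaK).
rewrite DE !linear_sum /=; apply: eq_big_seq => u /sI uI.
rewrite antipode_fold_tens -mulrA -(kac_mul DeltaK) qE // linearZ /=.
rewrite -scalerAr linearZ /= slice_mull (kac_haar DeltaK) -scalerAr mulr1.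
by rewrite slice_tens !linearZ /= !scalerA mulrC.
Qed.

(** Apply the counit to the second leg of [S x1 x2 (x) x3 = 1 (x) x]. *)
Lemma antipode_mul x :
  \sum_g lam C g^-1%g * row_of (Delta x) g = counit x *: 1.
Proof.
rewrite -(slice_tens (@counit C gT)) -(kac_antipode DeltaK) linear_sum /=.
under eq_bigr => g _ do rewrite [row_of _ _]galg_lam_sum mulr_sumr.
rewrite pair_big; apply: eq_bigr => -[g h] _ /=.
by rewrite linearZ /= slice_mull (kac_counit DeltaK) ffunE scalerAr.
Qed.

Section JonesProjection.
Variable I : {vspace A}.
Hypothesis cI : coideal_subalgebra Delta I.

Lemma jones_projP : jones_spec I (jones_proj I).
Proof. by case: cI => I1 IM IS _; case: (jones_specP I1 IM IS). Qed.

Lemma counit_jones : counit (jones_proj I) = 1.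
Proof.
case: jones_projP => [[pp _] p0 pI /(_ _ pI)/eqP].
rewrite pp -{1}[jones_proj I]scale1r -subr_eq0 -scalerBl scaler_eq0.
by rewrite (negPf p0) orbF subr_eq0 => /eqP.
Qed.

Lemma jones_haar_neq0 : (jones_proj I) 1%g != 0.
Proof.
case: jones_projP => [[pp ps] p0 _ _]; apply: contra p0 => /eqP h0.
by apply/eqP/star_mul_eq0; rewrite ps pp.
Qed.

(** Writing [Delta p] through a basis [b_i] of [I] and its dual basis [y_i] for
    the Haar form gives [Delta p = h(p) \sum_i S y_i (x) b_i]; multiplying the
    legs by the antipode axiom yields [1 = h(p) \sum_i y_i b_i], and the Haar
    state of the right-hand side is [h(p) \dim I]. *)
Lemma haar_jones_dim : (jones_proj I) 1%g * (\dim I)%:R = 1.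
Proof.
set p := jones_proj I; case: (cI) => _ _ IS ID.
have [_ _ pI pE] := jones_projP; rewrite -/p in pI pE.
have /in_tensP DpI := ID _ pI.
pose b := vbasis I.
have dual (i : 'I_(\dim I)) : exists2 y, y \in I & {in I, coord b i =1 haar y}.
  have cm := GRing.isLinear.Build C A C *%R (coord b i)
    (@linearP _ _ _ _ (coord b i)).
  pose cl : {scalar A} := HB.pack (coord b i : A -> C) cm.
  exact: (haar_representation cl IS).
have := antipode_mul p; rewrite counit_jones scale1r => /ffunP/(_ 1%g).
rewrite [RHS]lamE eqxx -[RHS]/1 => E1; rewrite -[RHS]E1 {E1}.
have rowE g : row_of (Delta p) g = \sum_i coord b i (row_of (Delta p) g) *: b`_i.
  exact/coord_vbasis/DpI.
under eq_bigr => g _ do rewrite rowE mulr_sumr.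
rewrite exchange_big galg_sumE /=.
have termE (i : 'I_(\dim I)) :
    (\sum_g lam C g^-1%g * (coord b i (row_of (Delta p) g) *: b`_i)) 1%g = p 1%g.
  have [y yI yE] := dual i.
  have bI : b`_i \in I by rewrite vbasis_mem ?mem_nth ?size_tuple.
  under eq_bigr => g _ do rewrite -scalerAr scalerAl.
  rewrite -mulr_suml.
  have -> : \sum_g coord b i (row_of (Delta p) g) *: lam C g^-1%g = p 1%g *: y.
    rewrite -[y]antipodeK -linearZ -(slice_haar_coproduct pE (ID _ yI)).
    rewrite /= antipodeE; apply: eq_bigr => g _.
    by rewrite ffunE yE //; apply: DpI.
  rewrite -scalerAl galgZE -/(haar y _) -yE // coord_free ?eqxx ?mulr1 //.
  exact: basis_free (vbasisP I).
rewrite (eq_bigr _ (fun i _ => termE i)).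
by rewrite sumr_const card_ord mulr_natr.
Qed.

End JonesProjection.

(** Two elements [x] of [I] and [y] of [J] with the same Haar form on [J] have
    the same image under [slice_haar_coproduct] applied to [q]; so [x = y]. *)
Lemma jones_proj_mul_subv I J :
    coideal_subalgebra Delta I -> coideal_subalgebra Delta J ->
    jones_proj I * jones_proj J = jones_proj J ->
  (I <= J)%VS.
Proof.
move=> cI cJ pq; set q := jones_proj J in pq.
have [_ _ _ pE] := jones_projP cI; have [_ _ qJ qE] := jones_projP cJ.
rewrite -/q in qJ qE; have [_ _ JS JD] := cJ; have [_ _ _ ID] := cI.
have qI : {in I, forall x, x * q = counit x *: q}.
  by move=> x xI; rewrite -pq mulrA pE // -scalerAl.
apply/subvP=> x xI; have [y yJ xyE] := haar_representation (haar x) JS.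
have := slice_haar_coproduct qI (ID _ xI).
rewrite (eq_slice (psi := haar y) (JD _ qJ)) //.
rewrite (slice_haar_coproduct qE (JD _ yJ)).
move=> /(scalerI (jones_haar_neq0 cJ)) /(inv_inj (@antipodeK C gT)) <-; exact: yJ.
Qed.

(** The Jones projection [q] of [I(f)] lies below [f], since [f q = eps(f) q];
    hence [I(f)] contains every coideal subalgebra whose Jones projection
    lies above [f]. *)
Lemma subv_coideal_gen I f :
    coideal_subalgebra Delta I -> counit f = 1 -> jones_proj I * f = f ->
  (I <= coideal_gen Delta f)%VS.
Proof.
move=> cI f1 pf; have [cJ fJ _] := coideal_genP Delta f.
apply: jones_proj_mul_subv => //; have [_ _ _ qE] := jones_projP cJ.
by rewrite -[jones_proj (coideal_gen _ _)]scale1r -f1 -qE // mulrA pf.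
Qed.

End KacCoproduct.

(** * Ranks of idempotents in the regular representation *)

Section TraceParity.

(** The two factors of a rank factorization [E = L *m U] of an idempotent
    satisfy [U *m L = 1], so that [\tr (L *m U) = \tr (U *m L)] is the rank. *)
Lemma mxtrace_idempotent (F : fieldType) n (E : 'M[F]_n) :
  E *m E = E -> \tr E = (\rank E)%:R.
Proof.
move=> EE; rewrite -{1}(mulmx_base E) mxtrace_mulC.
suff -> : row_base E *m col_base E = 1%:M by rewrite mxtrace1.
apply: (row_free_inj (row_base_free E)); apply: (row_full_inj (col_base_full E)).
by rewrite /= mul1mx -mulmxA mulmxA !mulmx_base.
Qed.

Variables (C : numClosedFieldType) (gT : finGroupType).
Implicit Types (f x y : galg C gT).

(** The sum is the trace of [x |-> f x y], an idempotent operator because left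
    and right multiplications commute. *)
Lemma trace_two_sided_idempotent f y :
  f * f = f -> y * y = y -> exists r : nat, \sum_g (f * lam C g * y) g = r%:R.
Proof.
move=> ff yy; pose E : 'M[C]_#|gT| :=
  \matrix_(i, j) (f * lam C (enum_val i) * y) (enum_val j).
exists (\rank E); rewrite -mxtrace_idempotent /mxtrace.
  rewrite (reindex (@enum_val gT gT)) /=; last exact/onW_bij/enum_val_bij.
  by apply: eq_bigr => i _; rewrite mxE.
apply/matrixP=> i j; rewrite !mxE; set x := f * lam C (enum_val i) * y.
have -> : x = f * x * y by rewrite /x !mulrA ff -[RHS]mulrA yy.
rewrite [x in RHS]galg_lam_sum mulr_sumr mulr_suml galg_sumE /=.
rewrite [RHS](reindex (@enum_val gT gT)) /=; last exact/onW_bij/enum_val_bij.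
by apply: eq_bigr => k _; rewrite !mxE -scalerAr -scalerAl galgZE.
Qed.

Lemma haar_idempotent f :
  f * f = f -> exists r : nat, #|gT|%:R * f 1%g = r%:R.
Proof.
move=> ff; have [r rE] := trace_two_sided_idempotent ff (mulr1 1).
exists r; rewrite -rE mulr_natl -sumr_const; apply: eq_bigr => g _.
by rewrite mulr1 mul_lamE mulgV.
Qed.

(** The involution [b] acts on the range of [f] by right multiplication, with
    trace [\sum_g f (g b g^-1)]; when this vanishes its two eigenspaces have
    the same dimension. *)
Lemma haar_idempotent_even f (b : gT) :
    f * f = f -> (b ^+ 2 = 1)%g -> \sum_g f (g * b * g^-1)%g = 0 ->
  exists r : nat, #|gT|%:R * f 1%g = (2 * r)%N%:R.
Proof.
move=> ff b2 tb; pose y : galg C gT := 2^-1 *: (1 + lam C b).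
have nz2 : 2 != 0 :> C by rewrite pnatr_eq0.
have bV : (b^-1 = b)%g by apply/eqP; rewrite eq_invg_mul -expg2 b2.
have yy : y * y = y.
  rewrite /y -scalerAl -scalerAr scalerA; rewrite mulrDl !mulrDr !mul1r mulr1.
  rewrite lamM -expg2 b2 -/(1 : galg C gT) [lam C b + 1]addrC -mulr2n.
  by rewrite -[(1 + _) *+ 2]scaler_nat scalerA mulfVK.
have [r rE] := trace_two_sided_idempotent ff yy.
exists r; rewrite natrM -rE -[LHS](mulVKf nz2); congr (_ * _).
have -> : \sum_g (f * lam C g * y) g =
          \sum_g 2^-1 * (f 1%g + f (g * b * g^-1)%g).
  apply: eq_bigr => g _; rewrite /y -scalerAr galgZE mulrDr mulr1 ffunE.
  by rewrite !mul_lamE mulgV bV.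
by rewrite -mulr_sumr big_split /= tb addr0 sumr_const mulr_natl.
Qed.
End TraceParity.

(** * Twists by the Klein four-group *)

Section KleinTwist.
Variables (C : numClosedFieldType) (gT : finGroupType).
Local Notation A := (galg C gT).
Local Notation AA := (galg C (gT * gT)%type).
Local Notation V := (bool * bool)%type.

Variables (h : V -> gT) (w : V -> V -> C).
Hypothesis hD : forall u v, h (u + v) = (h u * h v)%g.

Let addVV (u : V) : u + u = 0.
Proof. by case: u => -[] []. Qed.

Lemma klein_img0 : h 0 = 1%g.
Proof. by apply: (mulgI (h 0)); rewrite -hD addr0 mulg1. Qed.

Lemma klein_imgV u : (h u)^-1%g = h u.
Proof. by apply/eqP; rewrite eq_invg_mul -hD addVV klein_img0. Qed.

Lemma klein_imgC u v : commute (h u) (h v).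
Proof. by rewrite /commute -!hD addrC. Qed.

Definition twist_elt : AA :=
  \sum_(p : V * V) w p.1 p.2 *: lam C (h p.1, h p.2).
Local Notation Omega := twist_elt.

Definition twist_coprod (x : A) : AA := Omega * coprod_s x * star Omega.

Hypothesis w_unitary : forall s t,
  \sum_(p : V * V) w p.1 p.2 * (w (s + p.1) (t + p.2))^* =
  ((s == 0) && (t == 0))%:R.

(** This symmetry plays the part of the 2-cocycle identity. Since the [h u]
    commute and are involutions, the left factors [Omega] that occur in
    [S x1 x2 (x) x3] collect into [Omega] times the sum of the
    [w u v *: lam (h u * h v, h v)]; the symmetry identifies this sum with
    [star Omega], and unitarity makes the product [1]. *)
Hypothesis w_sym : forall u v, (w u v)^* = w (u + v) v.
Hypothesis w_counit : forall u, \sum_v w u v = (u == 0)%:R.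

Lemma twist_star :
  star Omega = \sum_(p : V * V) (w p.1 p.2)^* *: lam C (h p.1, h p.2).
Proof.
rewrite star_sum; apply: eq_bigr => p _; rewrite starZ star_lam.
by congr (_ *: lam C _); rewrite -[LHS]/(_, _) /= !klein_imgV.
Qed.

Lemma twist_star_sym :
  star Omega = \sum_(p : V * V) w p.1 p.2 *: lam C (h p.1 * h p.2, h p.2)%g.
Proof.
rewrite twist_star (reindex_inj (h := fun p : V * V => (p.1 + p.2, p.2))) /=.
  by apply: eq_bigr => p _; rewrite w_sym -addrA addVV addr0 hD.
move=> [u v] [u' v'] /eqP/andP[/eqP /= E1 /eqP/= E2].
by move: E1; rewrite E2 => /addIr ->.
Qed.

Lemma twist_sym :
  Omega = \sum_(p : V * V) (w p.1 p.2)^* *: lam C (h p.1 * h p.2, h p.2)%g.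
Proof.
rewrite -[LHS]starK twist_star_sym star_sum; apply: eq_bigr => p _.
rewrite starZ star_lam; congr (_ *: lam C _).
by rewrite -[LHS]/(_, _) /= invMg !klein_imgV klein_imgC.
Qed.

Lemma twist_unitary : Omega * star Omega = 1.
Proof.
rewrite twist_star mulr_suml.
have shift (p : V * V) : w p.1 p.2 *: lam C (h p.1, h p.2) *
    (\sum_(q : V * V) (w q.1 q.2)^* *: lam C (h q.1, h q.2)) =
  \sum_(q : V * V) (w p.1 p.2 * (w (q.1 + p.1) (q.2 + p.2))^*) *:
     lam C (h q.1, h q.2).
  rewrite mulr_sumr (reindex_inj (h := fun q : V * V => (q.1 + p.1, q.2 + p.2))) /=.
    apply: eq_bigr => q _; rewrite -scalerAl -scalerAr scalerA lamM.
    congr (_ *: lam C _); rewrite -[LHS]/(_, _) /= -!hD.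
    by congr (h _, h _); rewrite addrCA addVV addr0.
  by move=> [u v] [u' v'] /eqP/andP[/eqP/= /addIr -> /eqP/= /addIr ->].
under eq_bigr do rewrite shift.
rewrite exchange_big (bigD1 ((0, 0) : V * V)) //= [X in _ + X]big1 => [|[s t]].
  by rewrite -scaler_suml w_unitary !eqxx scale1r addr0 klein_img0.
by rewrite xpair_eqE -scaler_suml w_unitary /= => /negPf ->; rewrite scale0r.
Qed.

Lemma twist_comm u v : GRing.comm Omega (lam C (h u, h v)).
Proof.
apply/commr_sym/commr_sum => p _; rewrite /GRing.comm -scalerAl -scalerAr !lamM.
by congr (_ *: lam C _); congr (_, _); exact: klein_imgC.
Qed.

Lemma twist_star_comm u v : GRing.comm (star Omega) (lam C (h u, h v)).
Proof.
rewrite twist_star; apply/commr_sym/commr_sum => p _.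
rewrite /GRing.comm -scalerAl -scalerAr !lamM.
by congr (_ *: lam C _); congr (_, _); exact: klein_imgC.
Qed.

Lemma twist_unitaryV : star Omega * Omega = 1.
Proof.
rewrite -twist_unitary; apply/commr_sum => p _.
by rewrite /GRing.comm -scalerAl -scalerAr twist_star_comm.
Qed.

Fact twist_coprod_is_linear : linear twist_coprod.
Proof.
move=> c x y; rewrite /twist_coprod linearP mulrDr mulrDl.
by rewrite -scalerAr -scalerAl.
Qed.
HB.instance Definition _ :=
  GRing.isLinear.Build C A AA *:%R twist_coprod twist_coprod_is_linear.

Lemma twist_coprod_lam g : twist_coprod (lam C g) =
  \sum_(p : V * V) \sum_(q : V * V) (w p.1 p.2 * (w q.1 q.2)^*) *:
     lam C (h p.1 * (g * h q.1), h p.2 * (g * h q.2))%g.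
Proof.
rewrite /twist_coprod coprod_s_lam twist_star -mulrA mulr_suml.
apply: eq_bigr => p _; rewrite !mulr_sumr; apply: eq_bigr => q _.
by rewrite -!scalerAr -scalerAl scalerA [(w q.1 _)^* * _]mulrC !lamM.
Qed.

(** The trace of [lam (h u * (g * h v))] vanishes unless [g] lies in the image
    of [h]; in that case [g] commutes with [Omega], which then cancels. *)
Lemma twist_slice_haar x : slice (haar 1) (twist_coprod x) = x 1%g *: 1.
Proof.
rewrite {1}[x]galg_lam_sum !linear_sum /=.
rewrite (bigD1 1%g) //= !linearZ /= big1 ?addr0 => [|g ng1].
  rewrite /twist_coprod coprod_s_lam mulr1 twist_unitary -tens11 slice_tens.
  by rewrite /= haar1E lamE eqxx scale1r.
rewrite !linearZ /=; apply/eqP; rewrite scaler_eq0; apply/orP; right.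
have [/codomP[u gu]|gh] := boolP (g \in codom h).
  rewrite /twist_coprod coprod_s_lam {1 2}gu -mulrA -twist_star_comm mulrA.
  rewrite twist_unitary mul1r -gu -tens_lam slice_tens /= haar1E lamE.
  by rewrite [(1 == g)%g]eq_sym (negPf ng1) scale0r.
rewrite twist_coprod_lam linear_sum big1 // => p _.
rewrite linear_sum big1 // => q _ /=; rewrite linearZ /= -tens_lam slice_tens /=.
rewrite haar1E lamE; case: eqP => [E|_]; last by rewrite scale0r scaler0.
case/negP: gh; apply/codomP; exists (p.2 + q.2); rewrite hD.
apply: (mulgI (h p.2)); apply: (mulIg (h q.2)); rewrite -mulgA -E.
by rewrite -!mulgA mulgA -!hD !addVV klein_img0.
Qed.

Lemma twist_slice_counit x : slice (@counit C gT) (twist_coprod x) = x.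
Proof.
have s1 : slice (@counit C gT) Omega = 1.
  have rowE u : slice (@counit C gT) (\sum_v w u v *: lam C (h u, h v)) =
                (u == 0)%:R *: lam C (h u).
    rewrite linear_sum -w_counit scaler_suml; apply: eq_bigr => v _ /=.
    by rewrite linearZ /= -tens_lam slice_tens /= counit_lam scale1r.
  rewrite /twist_elt -(pair_bigA _ (fun u v => w u v *: lam C (h u, h v))).
  rewrite linear_sum (bigD1 (0 : V)) //= [X in _ + X]big1 ?addr0 => [|u /negPf nu].
    by rewrite rowE eqxx scale1r klein_img0.
  by rewrite rowE nu scale0r.
have s2 : slice (@counit C gT) (star Omega) = 1.
  rewrite -[LHS]mul1r -s1 -slice_counitM twist_unitary -tens11 slice_tens /=.
  by rewrite counit1 scale1r.
rewrite /twist_coprod !slice_counitM s1 s2 mul1r mulr1.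
rewrite [in RHS](galg_lam_sum x) /coprod_s linear_sum; apply: eq_bigr => g _.
by rewrite linearZ /= slice_tens /= counit_lam scale1r.
Qed.

Lemma twist_antipode x :
  antipode_fold twist_coprod (twist_coprod x) = tens 1 x.
Proof.
have lam1 : Omega * star Omega =
    \sum_(p : V * V) w p.1 p.2 *:
       (lam C (h p.1, 1%g) * Omega * lam C (h p.2, h p.2)).
  rewrite {1}twist_star_sym mulr_sumr; apply: eq_bigr => p _.
  rewrite -scalerAr -klein_img0 -twist_comm -mulrA lamM; congr (_ *: (_ * lam C _)).
  by rewrite -[RHS]/(_, _) /= klein_img0 mul1g.
rewrite [x]galg_lam_sum !linear_sum; apply: eq_bigr => g _.
rewrite !linearZ /=; congr (_ *: _); rewrite [1 in RHS]/(lam C 1%g) tens_lam.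
(* The left factors [Omega] cancel for each term [q] of [star Omega]; the
   remaining sum over [q] is again [Omega * star Omega], by [twist_sym]. *)
have fold_q (q : V * V) :
  \sum_(p : V * V) w p.1 p.2 *: antipode_fold twist_coprod
     (lam C (h p.1 * (g * h q.1), h p.2 * (g * h q.2))%g) =
  lam C (1, g)%g * (lam C (h q.1 * h q.2, h q.2)%g * star Omega).
  transitivity (lam C ((g * h q.1)^-1, 1)%g * (Omega * star Omega) *
    lam C (g * h q.2, g * h q.2)%g * star Omega).
    rewrite lam1 mulr_sumr !mulr_suml; apply: eq_bigr => p _.
    rewrite antipode_fold_lam /twist_coprod coprod_s_lam.
    rewrite -scalerAr -!scalerAl; congr (_ *: _); rewrite !mulrA; congr (_ * _).
    rewrite lamM -[RHS]mulrA lamM; congr (lam C _ * _ * _).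
    by rewrite -[RHS]/(_, _) /= invMg klein_imgV mulg1.
  rewrite twist_unitary mulr1 mulrA !lamM; congr (lam C _ * _).
  rewrite -[LHS]/(_, _) -[RHS]/(_, _) /= !mul1g.
  by rewrite invMg -mulgA mulKg klein_imgV.
rewrite twist_coprod_lam exchange_big !linear_sum /=.
transitivity (\sum_(q : V * V) (w q.1 q.2)^* *:
    (lam C (1, g)%g * (lam C (h q.1 * h q.2, h q.2)%g * star Omega))).
  apply: eq_bigr => q _; rewrite -fold_q scaler_sumr linear_sum.
  by apply: eq_bigr => p _; rewrite linearZ /= scalerA mulrC.
rewrite -[RHS]mulr1 -twist_unitary {2}twist_sym mulr_suml mulr_sumr.
by apply: eq_bigr => q _; rewrite -scalerAl -scalerAr.
Qed.

(** Twisting by [Omega] preserves the counit, the antipode and the Haar state of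
    the group algebra. *)
Lemma kac_twist_coprod : kac_coproduct twist_coprod.
Proof.
split.
- exact: twist_coprod_is_linear.
- move=> x y; rewrite /twist_coprod coprod_sM -!mulrA.
  by rewrite [star Omega * (Omega * _)]mulrA twist_unitaryV mul1r.
- exact: twist_slice_counit.
- exact: twist_antipode.
- exact: twist_slice_haar.
Qed.

End KleinTwist.

(** * The cocycle of [KD(n)] *)

Section KleinCocycle.
Variables (C : numClosedFieldType).
Local Notation V := (bool * bool)%type.

(** The indices of the table [KD_c] as elements of the Klein group: the two
    coordinates are the exponents of [b] and of [a ^+ n] in [KD_h]. *)
Definition klein_ord (u : V) : 'I_4 := inord (u.1.*2 + u.2).

Definition klein_cocycle (u v : V) : C := KD_c C (klein_ord u) (klein_ord v).

Lemma klein_ordE u : klein_ord u = (u.1.*2 + u.2)%N :> nat.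
Proof. by rewrite inordK //; case: u => -[] []. Qed.

Lemma klein_ord_bij : bijective klein_ord.
Proof.
apply: inj_card_bij; last by rewrite card_prod card_bool card_ord.
by move=> [[] []] [[] []] /(congr1 val) /=; rewrite !klein_ordE.
Qed.

Lemma klein_cocycle_sym u v :
  (klein_cocycle u v)^* = klein_cocycle (u + v) v.
Proof.
rewrite /klein_cocycle /KD_c !klein_ordE.
move: u v => [[] []] [[] []] /=.
all: by rewrite rmorphM fmorphV ?rmorph1 !rmorph_nat /= ?conjCK.
Qed.

Lemma big_klein (R : nmodType) (F : V -> R) :
  \sum_u F u = F (false, false) + F (false, true) +
               (F (true, false) + F (true, true)).
Proof.
rewrite (eq_bigr (fun u => F (u.1, u.2))) => [|[]] //.
rewrite -(pair_bigA _ (fun x y => F (x, y))) /= !big_bool /=.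
by rewrite addrC; congr (_ + _); rewrite addrC.
Qed.

Let nuC : (KD_nu C)^* = - 2 - KD_nu C.
Proof.
rewrite /KD_nu rmorphD rmorphM rmorphN1 rmorph_nat /= conjCi; ring.
Qed.

Lemma klein_cocycle_counit u : \sum_v klein_cocycle u v = (u == 0)%:R.
Proof.
rewrite big_klein /klein_cocycle /KD_c !klein_ordE; move: u => [[] []] /=.
all: by rewrite ?nuC; field.
Qed.

Lemma klein_cocycle_unitary s t :
  \sum_(p : V * V) klein_cocycle p.1 p.2 * (klein_cocycle (s + p.1) (t + p.2))^* =
  ((s == 0) && (t == 0))%:R.
Proof.
have nu2 : KD_nu C ^+ 2 = - 2 * KD_nu C - 5.
  have i2 := sqrCi C; rewrite /KD_nu; ring: i2.
under eq_bigr do rewrite klein_cocycle_sym.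
rewrite -(pair_bigA _ (fun u v =>
  klein_cocycle u v * klein_cocycle (s + u + (t + v)) (t + v))) /=.
rewrite !big_klein /klein_cocycle /KD_c !klein_ordE.
move: s t => [[] []] [[] []] /=; rewrite !nuC.
all: by field: nu2.
Qed.
End KleinCocycle.

(** * The dihedral group and the coproduct of [KD(n)] *)

Section Dihedral.
Variables (C : numClosedFieldType) (n : nat).
Local Notation D := ('D_(4 * n)%N)%type.
Hypothesis n_gt0 : (0 < n)%N.
Variables a b : D.
Hypothesis ab_gens : dihedral_gens a b.
Local Notation V := (bool * bool)%type.

Let aV : (a ^+ (2 * n) = 1)%g. Proof. by case: ab_gens. Qed.
Let b2 : (b ^+ 2 = 1)%g. Proof. by case: ab_gens. Qed.
Let bV : (b^-1 = b)%g. Proof. by apply/eqP; rewrite eq_invg_mul -expg2 b2. Qed.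

Lemma dihedral_mulbX k : (b * a ^+ k = a ^- k * b)%g.
Proof.
have [_ _ ba _] := ab_gens; elim: k => [|k IH].
  by rewrite expg0 invg1 mulg1 mul1g.
by rewrite [in LHS]expgSr mulgA IH -mulgA ba mulgA expgS invMg.
Qed.

Lemma dihedral_mulbX_sym k : (b * a ^- k = a ^+ k * b)%g.
Proof.
rewrite -[X in _ = (X * b)%g](mulKg b) dihedral_mulbX bV -!mulgA.
by rewrite -expg2 b2 mulg1.
Qed.

Lemma card_D4n : #|D| = (4 * n)%N.
Proof.
have q1 : (1 < 2 * n)%N by rewrite (leq_mul (leqnn 2) n_gt0).
by have := card_dihedral q1; rewrite cardsT -mul2n mulnA.
Qed.

Definition dihedral_word (p : 'I_(2 * n) * bool) : D := (a ^+ p.1 * b ^+ p.2)%g.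

Lemma dihedral_word_bij : bijective dihedral_word.
Proof.
have cardE : #|{: 'I_(2 * n) * bool}| = #|D|.
  by rewrite card_prod card_ord card_bool card_D4n mulnAC.
suff onto : dihedral_word @: [set: 'I_(2 * n) * bool] = [set: D].
  apply: inj_card_bij; last by rewrite cardE.
  have inj : {in [set: 'I_(2 * n) * bool] &, injective dihedral_word}.
    by apply/imset_injP; rewrite onto !cardsT cardE.
  by move=> p q; apply: inj; rewrite inE.
apply/eqP; rewrite eqEsubset subsetT /=.
have [_ _ ba gen] := ab_gens; rewrite -gen.
have -> : <<[set a; b]>>%g = (<[a]> * <[b]>)%g.
  rewrite -[LHS]/([set a] <*> [set b])%g -joing_idl -joing_idr.
  apply: norm_joinEr; rewrite cycle_subG.
  apply/normP; rewrite -cycleJ conjgE bV mulgA ba -mulgA -expg2 b2 mulg1.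
  exact: cycleV.
apply/subsetP=> g /mulsgP[x y /cycleP[i ->] /cycleP[j ->] ->].
have i2n : (i %% (2 * n) < 2 * n)%N by rewrite ltn_pmod ?muln_gt0.
apply/imsetP; exists (Ordinal i2n, odd j); first by rewrite inE.
by rewrite /dihedral_word /= -modn2 !expg_mod.
Qed.

Lemma big_dihedral (R : nmodType) (F : D -> R) :
  \sum_g F g = \sum_(k < (2 * n)%N) (F (a ^+ k)%g + F (a ^+ k * b)%g).
Proof.
rewrite (reindex dihedral_word) /=; last exact/onW_bij/dihedral_word_bij.
rewrite -(pair_bigA _ (fun k j => F (dihedral_word (k, j)))) /=.
by apply: eq_bigr => k _; rewrite big_bool addrC /dihedral_word /= mulg1.
Qed.

Lemma dihedral_expg_eq1 (k : 'I_(2 * n)) : ((a ^+ k)%g == 1%g) = (k == 0 :> nat).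
Proof.
apply/eqP/eqP => [ak1|->]; last exact: expg0.
have k0 : (0 < 2 * n)%N by rewrite muln_gt0.
have : dihedral_word (k, false) = dihedral_word (Ordinal k0, false).
  by rewrite /dihedral_word /= ak1.
by move/(bij_inj dihedral_word_bij) => [->].
Qed.

Lemma dihedral_mulb_neq1 (k : 'I_(2 * n)) : (b * a ^+ k)%g == 1%g = false.
Proof.
apply/negbTE/eqP => bak1.
have k0 : (0 < 2 * n)%N by rewrite muln_gt0.
have : dihedral_word (k, false) = dihedral_word (Ordinal k0, true).
  apply: (mulgI b); rewrite /dihedral_word /= mulg1 bak1 mul1g.
  by rewrite -expg2 b2.
by move/(bij_inj dihedral_word_bij).
Qed.

(** The coproduct of [KD(n)] is the twist by the Klein four-group generated by
    [b] and the central involution [a ^+ n]. *)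
Definition klein_img (u : V) : D := (b ^+ u.1 * (a ^+ n) ^+ u.2)%g.

Lemma klein_imgD u v : klein_img (u + v) = (klein_img u * klein_img v)%g.
Proof.
have c2 : ((a ^+ n) ^+ 2 = 1)%g by rewrite -expgM [(n * 2)%N]mulnC.
have cb : commute (a ^+ n)%g b.
  rewrite /commute dihedral_mulbX; congr (_ * _)%g.
  by apply/esym/eqP; rewrite eq_invg_mul -expg2 c2.
have cbX (i j : bool) : ((a ^+ n) ^+ i * b ^+ j = b ^+ j * (a ^+ n) ^+ i)%g.
  exact: commuteX2.
have involX (x : D) (i j : bool) :
    (x ^+ 2 = 1)%g -> (x ^+ (i + j)%R = x ^+ i * x ^+ j)%g.
  by case: i; case: j => x2; rewrite /= ?mulg1 ?mul1g // -expg2 x2.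
case: u v => [u1 u2] [v1 v2]; rewrite /klein_img /= !involX //.
by rewrite -!mulgA; congr (_ * _)%g; rewrite !mulgA cbX.
Qed.

Lemma KD_Omega_twist : KD_Omega C a b = twist_elt klein_img (@klein_cocycle C).
Proof.
have hE u : KD_h a b (klein_ord u) = klein_img u.
  rewrite /KD_h klein_ordE /klein_img.
  by case: u => [[] []] /=; rewrite ?mulg1 ?mul1g.
rewrite /KD_Omega /twist_elt -(pair_bigA _ (fun u v : V =>
  klein_cocycle C u v *: lam C (klein_img u, klein_img v))) /=.
rewrite (reindex (klein_ord)) /=; last exact/onW_bij/klein_ord_bij.
apply: eq_bigr => u _.
rewrite (reindex (klein_ord)) /=; last exact/onW_bij/klein_ord_bij.
by apply: eq_bigr => v _; rewrite tens_lam !hE.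
Qed.

Lemma KD_coprod_kac : kac_coproduct (KD_coprod a b : KD C n -> _).
Proof.
have := kac_twist_coprod klein_imgD (@klein_cocycle_unitary C)
  (@klein_cocycle_sym C) (@klein_cocycle_counit C).
by rewrite /KD_coprod KD_Omega_twist.
Qed.

End Dihedral.

(** * The one-dimensional representations *)

Section LinearCharacters.
Variables (C : numClosedFieldType) (n : nat).
Local Notation D := ('D_(4 * n)%N)%type.
Local Notation A := (galg C D).
Local Notation V := (bool * bool)%type.
Hypothesis n_gt0 : (0 < n)%N.
Variables a b : D.
Hypothesis ab_gens : dihedral_gens a b.

Fact char_key : unit. Proof. exact: tt. Qed.

(** The minimal central projection of the character sending [a] to
    [(-1) ^+ u.1] and [b] to [(-1) ^+ u.2]. It is locked, like [linear_char]
    below, so that comparing two of its values by conversion does not compute in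
    the group algebra. *)
Definition char_idem : V -> A := locked_with char_key (fun u : V =>
  (4 * n)%N%:R^-1 *: \sum_(k < (2 * n)%N)
    (-1) ^+ (u.1 * k) *:
      (lam C (a ^+ k)%g + (-1) ^+ u.2 *: lam C (b * a ^+ k)%g)).
Local Notation E := char_idem.

Lemma char_idem_sumE u : E u = (4 * n)%N%:R^-1 *: \sum_(k < (2 * n)%N)
  (-1) ^+ (u.1 * k) *:
    (lam C (a ^+ k)%g + (-1) ^+ u.2 *: lam C (b * a ^+ k)%g).
Proof. by rewrite /char_idem unlock. Qed.

Lemma big_ord_cyclic (R : zmodType) m (F : nat -> R) :
  F m = F 0%N -> \sum_(k < m) F k.+1 = \sum_(k < m) F k.
Proof.
move=> Fm; apply: (addrI (F 0%N)).
transitivity (\sum_(k < m.+1) F k); first by rewrite big_ord_recl.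
by rewrite big_ord_recr /= Fm addrC.
Qed.

Let scaleC (c d : C) (x : A) : c *: (d *: x) = d *: (c *: x).
Proof. by rewrite !scalerA mulrC. Qed.

Let sign2 (s : nat) : (-1) ^+ s * (-1) ^+ s = 1 :> C.
Proof. by rewrite -expr2 -exprM mulnC exprM sqrrN !expr1n. Qed.

Let sign2n (i : bool) : (-1) ^+ (i * (2 * n)) = 1 :> C.
Proof. by rewrite mulnCA exprM sqrrN !expr1n. Qed.

Lemma lama_char_idem u : lam C a * E u = (-1) ^+ u.1 *: E u.
Proof.
have [a2n _ ba _] := ab_gens.
rewrite char_idem_sumE -scalerAr scaleC; congr (_ *: _).
under eq_bigr do rewrite scalerDr.
rewrite big_split mulrDr scalerDr /=; congr (_ + _).
  pose F k := (-1) ^+ (u.1 * k) *: lam C (a ^+ k)%g.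
  rewrite -[X in _ = _ *: X](@big_ord_cyclic _ _ F); last first.
    by rewrite /F sign2n a2n muln0.
  rewrite mulr_sumr scaler_sumr; apply: eq_bigr => k _.
  rewrite -scalerAr lamM -expgS /F scalerA mulnS exprD mulrA.
  by rewrite sign2 mul1r.
pose G k := (-1) ^+ (u.1 * k) *: ((-1) ^+ u.2 *: lam C (b * a ^+ k)%g).
rewrite -[X in _ * X](@big_ord_cyclic _ _ G); last first.
  by rewrite /G sign2n a2n muln0.
rewrite mulr_sumr scaler_sumr; apply: eq_bigr => k _; rewrite /G mulnS exprD.
rewrite -!scalerAr lamM -scalerA; congr (_ *: (_ *: (_ *: lam C _))).
by rewrite expgS [(b * (a * _))%g]mulgA ba -mulgA mulKVg.
Qed.

Lemma lamb_char_idem u : lam C b * E u = (-1) ^+ u.2 *: E u.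
Proof.
have [_ b2 _ _] := ab_gens.
rewrite char_idem_sumE -scalerAr scaleC; congr (_ *: _).
rewrite mulr_sumr scaler_sumr; apply: eq_bigr => k _.
rewrite -scalerAr scaleC; congr (_ *: _).
rewrite mulrDr -scalerAr !lamM mulgA -expg2 b2 mul1g scalerDr scalerA.
by rewrite sign2 scale1r addrC.
Qed.

Lemma lamX_char_idem u k (j : bool) :
  lam C (a ^+ k * b ^+ j)%g * E u = (-1) ^+ (u.1 * k + u.2 * j) *: E u.
Proof.
have bE : lam C (b ^+ j)%g * E u = (-1) ^+ (u.2 * j) *: E u.
  by case: j; rewrite ?muln1 ?muln0 ?lamb_char_idem // mul1r scale1r.
rewrite -lamM -mulrA bE -scalerAr exprD mulrC -scalerA; congr (_ *: _).
elim: k => [|k IH]; first by rewrite muln0 mul1r scale1r.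
rewrite expgS -lamM -mulrA IH -scalerAr lama_char_idem scalerA.
by rewrite mulnS exprD mulrC.
Qed.

Lemma char_idem1 u : E u 1%g = (4 * n)%N%:R^-1.
Proof.
have n2 : (0 < 2 * n)%N by rewrite muln_gt0.
rewrite char_idem_sumE galgZE galg_sumE (bigD1 (Ordinal n2)) //= big1 => [|k nk].
  rewrite !galgZE muln0 expr0 mul1r ffunE !galgZE !lamE.
  rewrite [(1%g == (b * _)%g)]eq_sym.
  rewrite (dihedral_mulb_neq1 n_gt0 ab_gens (Ordinal n2)).
  by rewrite eqxx mulr0 !addr0 mulr1.
rewrite galgZE ffunE galgZE !lamE ![(1%g == _)]eq_sym.
rewrite (dihedral_mulb_neq1 n_gt0 ab_gens) (dihedral_expg_eq1 n_gt0 ab_gens).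
by rewrite [(_ == _)](negPf nk) mulr0 addr0 mulr0.
Qed.

(** The one-dimensional representation of [C[D_2n]] sending [a] to
    [(-1) ^+ u.1] and [b] to [(-1) ^+ u.2], read off from its action on the
    line spanned by [E u], whose coefficient at [1] is [1 / 4n]. *)
Definition linear_char : V -> A -> C := locked_with char_key
  (fun (u : V) (x : A) => (4 * n)%N%:R * (x * E u) 1%g).
Local Notation chi := linear_char.

Fact linear_char_is_scalar u : scalar (chi u).
Proof.
move=> c x y; rewrite /linear_char unlock mulrDl -scalerAl [in LHS]ffunE galgZE.
by rewrite mulrDr mulrCA.
Qed.
HB.instance Definition _ u :=
  GRing.isLinear.Build C A C *%R (chi u) (linear_char_is_scalar u).

Lemma linear_charZ u c x : chi u (c *: x) = c * chi u x.
Proof. exact: linearZ. Qed.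

Let nz4n : (4 * n)%N%:R != 0 :> C.
Proof. by rewrite pnatr_eq0 muln_eq0 /= eqn0Ngt n_gt0. Qed.

Let chi_scale u x c : x * E u = c *: E u -> chi u x = c.
Proof.
move=> xE; rewrite /linear_char unlock xE galgZE char_idem1 mulrCA.
by rewrite divff ?mulr1.
Qed.

Lemma linear_char_word u k (j : bool) :
  chi u (lam C (a ^+ k * b ^+ j)%g) = (-1) ^+ (u.1 * k + u.2 * j).
Proof. exact/chi_scale/lamX_char_idem. Qed.

Lemma mul_char_idem u x : x * E u = chi u x *: E u.
Proof.
rewrite {1}[x]galg_lam_sum [x in chi u x]galg_lam_sum linear_sum mulr_suml.
rewrite scaler_suml; apply: eq_bigr => g _.
rewrite /= linear_charZ -scalerA -scalerAl.
congr (_ *: _); have /codomP[[k j] ->] : g \in codom (@dihedral_word n a b).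
  by have [f _ fK] := dihedral_word_bij n_gt0 ab_gens; rewrite -[g]fK codom_f.
by rewrite /dihedral_word linear_char_word lamX_char_idem.
Qed.

Lemma linear_charM u : {morph chi u : x y / x * y}.
Proof.
move=> x y; apply: chi_scale; rewrite -mulrA !mul_char_idem -scalerAr.
by rewrite mul_char_idem scalerA mulrC.
Qed.

Lemma linear_char_sum u x :
  chi u x = \sum_(k < (2 * n)%N) (-1) ^+ (u.1 * k) *
              (x (a ^+ k)%g + (-1) ^+ u.2 * x (a ^+ k * b)%g).
Proof.
rewrite {1}[x]galg_lam_sum linear_sum (big_dihedral n_gt0 ab_gens).
apply: eq_bigr => k _; rewrite !linearZ /=.
have := linear_char_word u k false; rewrite muln0 addn0 expg0 mulg1 => ->.
have := linear_char_word u k true; rewrite muln1 expg1 exprD => ->.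
by rewrite mulrDr [in RHS]mulrA ![_ * x _]mulrC.
Qed.

Lemma linear_char0 x : chi 0 x = counit x.
Proof.
rewrite linear_char_sum /counit (big_dihedral n_gt0 ab_gens).
by apply: eq_bigr => k _; rewrite mul0n expr0 !mul1r.
Qed.

Let chi_lam_sign u g : exists s : nat, chi u (lam C g) = (-1) ^+ s.
Proof.
have [f _ fK] := dihedral_word_bij n_gt0 ab_gens; rewrite -[g]fK.
by eexists; apply: linear_char_word.
Qed.

Let chi_lamV u g : chi u (lam C g^-1%g) = chi u (lam C g).
Proof.
have [s sE] := chi_lam_sign u g.
have : chi u (lam C g^-1%g * lam C g) = 1.
  by rewrite lamM mulVg; apply: chi_scale; rewrite mul1r scale1r.
rewrite linear_charM sE => /(congr1 ( *%R^~ ((-1) ^+ s))).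
by rewrite -mulrA sign2 mulr1 mul1r.
Qed.

Lemma char_idemE u g : E u g = (4 * n)%N%:R^-1 * chi u (lam C g).
Proof.
rewrite -chi_lamV mulrC -(char_idem1 u) -galgZE -mul_char_idem lam_mulE.
by rewrite invgK mulg1.
Qed.

Lemma star_char_idem u : star (E u) = E u.
Proof.
apply/ffunP=> g; rewrite ffunE !char_idemE chi_lamV rmorphM fmorphV rmorph_nat.
by have [s ->] := chi_lam_sign u g; rewrite rmorphXn /= rmorphN1.
Qed.

Lemma linear_charE u x : chi u x = \sum_g x g * chi u (lam C g).
Proof.
by rewrite {1}[x]galg_lam_sum linear_sum; apply: eq_bigr => g _; rewrite linearZ.
Qed.

Lemma linear_char_star u x : chi u (star x) = (chi u x)^*.
Proof.
rewrite !linear_charE rmorph_sum (reindex_inj invg_inj); apply: eq_bigr => g _.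
rewrite ffunE invgK chi_lamV rmorphM; congr (_ * _).
by have [s ->] := chi_lam_sign u g; rewrite rmorphXn /= rmorphN1.
Qed.

Lemma linear_char_idem u v : chi u (E v) = (u == v)%:R.
Proof.
case: eqP => [->|/eqP nuv].
  rewrite linear_charE (eq_bigr (fun=> (4 * n)%N%:R^-1)) => [|g _].
    by rewrite sumr_const (card_D4n n_gt0) -[_ *+ _]mulr_natl divff.
  rewrite char_idemE -mulrA; have [s ->] := chi_lam_sign v g.
  by rewrite sign2 mulr1.
(* [lam g * E v] computed on either side of [chi u]: if [chi u (E v)] were
     nonzero, the two characters would agree on [a] and [b]. *)
have comm g : chi u (lam C g) * chi u (E v) = chi v (lam C g) * chi u (E v).
  transitivity (chi u (lam C g * E v)); first by rewrite linear_charM.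
  by rewrite mul_char_idem linear_charZ.
apply/eqP/negP => /negP nz; case/negP: nuv; apply/eqP.
have := linear_char_word u 1 false; have := linear_char_word v 1 false.
have := linear_char_word u 0 true; have := linear_char_word v 0 true.
rewrite !muln0 !muln1 add0n !addn0 !expg0 !expg1 mul1g mulg1 => vb ub va ua.
move: (comm a) (comm b) => /(mulIf nz) + /(mulIf nz).
rewrite va vb ua ub; case: u v {nz comm va vb ua ub} => [u1 u2] [v1 v2] /=.
by move=> /signr_inj -> /signr_inj ->.
Qed.

Lemma char_idem_mul u v : E u * E v = (u == v)%:R *: E u.
Proof.
rewrite mul_char_idem linear_char_idem [v == u]eq_sym.
by case: (u =P v) => [uv|_]; [rewrite uv|rewrite [LHS]scale0r [RHS]scale0r].
Qed.

Lemma char_idem_central u x : E u * x = x * E u.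
Proof.
rewrite -[LHS]starK starM star_char_idem mul_char_idem starZ star_char_idem.
by rewrite linear_char_star conjCK -mul_char_idem.
Qed.

(** The four characters span the functions on [D / <a ^ 2>], so an element
    which they all kill has coefficient sum zero over each coset of [<a ^ 2>].
    One of these cosets is the conjugacy class of [b]. *)
Lemma class_sum_eq0 f :
  (forall u, chi u f = 0) -> \sum_g f (g * b * g^-1)%g = 0.
Proof.
move=> f0.
have [a2n b2 _ _] := ab_gens.
have bV : (b^-1 = b)%g by apply/eqP; rewrite eq_invg_mul -expg2 b2.
pose F k := f (a ^+ k * b)%g.
have conjF k : f (a ^+ k * b * (a ^+ k)^-1)%g = F (2 * k)%N.
  rewrite /F -mulgA (dihedral_mulbX_sym ab_gens) mulgA -expgD addnn -mul2n //.
rewrite (big_dihedral n_gt0 ab_gens).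
have -> : \sum_(k < (2 * n)%N) (f (a ^+ k * b * (a ^+ k)^-1)%g +
            f (a ^+ k * b * b * (a ^+ k * b)^-1)%g) =
          2 * \sum_(k < (2 * n)%N) F (2 * k)%N.
  rewrite mulr_sumr; apply: eq_bigr => k _; rewrite conjF mulr2n mulrDl mul1r.
  congr (_ + _); rewrite -conjF invMg bV mulgA; congr (f (_ * _)%g).
  by rewrite -[(_ * b * b)%g]mulgA -expg2 b2 mulg1.
have Fper k : F (k + 2 * n)%N = F k by rewrite /F expgD a2n mulg1.
have split2 (G : nat -> C) m :
    \sum_(k < (2 * m)%N) (1 + (-1) ^+ k) * G k = 2 * \sum_(k < m) G (2 * k)%N.
  elim: m => [|m IH]; first by rewrite !big_ord0 mulr0.
  rewrite mulnS addnC !addnS addn0 !big_ord_recr /= IH exprS exprM sqrrN !expr1n.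
  by ring.
have per2 : \sum_(k < (2 * n)%N) F (2 * k)%N = 2 * \sum_(k < n) F (2 * k)%N.
  rewrite -(big_mkord xpredT (fun k => F (2 * k)%N)) mul2n -addnn big_mkord.
  rewrite big_split_ord /= mulr2n mulrDl mul1r; congr (_ + _).
  by apply: eq_bigr => k _; rewrite mulnDr addnC Fper.
rewrite per2 -split2; apply/eqP; rewrite mulf_eq0; apply/orP; right.
have nz2 : 2 != 0 :> C by rewrite pnatr_eq0.
rewrite -(inj_eq (mulfI nz2)) mulr0; apply/eqP.
(* Orthogonality of the four sign vectors isolates the coset of [b]. *)
transitivity (chi (false, false) f - chi (false, true) f +
              (chi (true, false) f - chi (true, true) f)); last first.
  by rewrite !f0 !subrr addr0.
rewrite !linear_char_sum -!sumrB -big_split mulr_sumr.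
by apply: eq_bigr => k _ /=; rewrite mul0n mul1n -/(F k); ring.
Qed.

Lemma linear_char_idempotent u (p : A) :
  p * p = p -> chi u p = (chi u p == 1)%:R.
Proof.
move=> pp; have /eqP : chi u p * chi u p = chi u p by rewrite -linear_charM pp.
move: (chi u p) => c /eqP cc; case: (c =P 1) => [-> //|/eqP c1].
have /eqP : (c - 1) * c = 0 by rewrite mulrBl mul1r cc subrr.
by rewrite mulf_eq0 subr_eq0 (negPf c1) => /eqP.
Qed.

(** An idempotent splits into its components on the lines [E u] and an
    idempotent in the sum of the two-dimensional blocks; the latter has even
    rank in the regular representation by [class_sum_eq0]. *)
Lemma haar_idempotent_mod2 (p : A) : p * p = p ->
  exists r : nat, (4 * n)%N%:R * p 1%g = (\sum_u (chi u p == 1%R) + 2 * r)%N%:R.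
Proof.
move=> pp; pose e := \sum_u E u.
have ee : e * e = e.
  rewrite mulr_suml; apply: eq_bigr => u _; rewrite mulr_sumr (bigD1 u) //=.
  rewrite char_idem_mul eqxx scale1r big1 ?addr0 // => v nv.
  by rewrite char_idem_mul eq_sym (negPf nv) scale0r.
have ep : e * p = p * e.
  by rewrite mulr_suml mulr_sumr; apply: eq_bigr => u _; apply: char_idem_central.
have peE : p * e = \sum_u chi u p *: E u.
  by rewrite mulr_sumr; apply: eq_bigr => u _; rewrite mul_char_idem.
pose f := p - p * e.
have ff : f * f = f.
  have pep : p * e * p = p * e by rewrite -mulrA ep mulrA pp.
  by rewrite /f mulrBl !mulrBr pp !mulrA pep pp -[p * e * e]mulrA ee subrr subr0.
have chif u : chi u f = 0.
  have chie : chi u e = 1.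
    rewrite linear_sum (bigD1 u) //= linear_char_idem eqxx big1 ?addr0 // => v nv.
    by rewrite linear_char_idem eq_sym (negPf nv).
  by rewrite linearB /= linear_charM chie mulr1 subrr.
have [_ b2 _ _] := ab_gens.
have [r rE] := haar_idempotent_even ff b2 (class_sum_eq0 chif).
exists r; rewrite natrD -rE (card_D4n n_gt0) -[p in LHS](subrK (p * e)) -/f.
rewrite ffunE mulrDr addrC; congr (_ + _).
rewrite peE galg_sumE mulr_sumr natr_sum; apply: eq_bigr => u _.
by rewrite galgZE char_idem1 mulrCA divff // mulr1 -linear_char_idempotent.
Qed.

Lemma char_idem_sum_mul (P : pred V) :
  (\sum_(u | P u) E u) * (\sum_(u | P u) E u) = \sum_(u | P u) E u.
Proof.
rewrite mulr_suml; apply: eq_bigr => u Pu; rewrite mulr_sumr (bigD1 u) //=.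
rewrite char_idem_mul eqxx scale1r big1 ?addr0 // => v /andP[_ nv].
by rewrite char_idem_mul eq_sym (negPf nv) scale0r.
Qed.

Lemma linear_char_idem_sum (P : pred V) u :
  chi u (\sum_(v | P v) E v) = (P u)%:R.
Proof.
rewrite linear_sum /= big_mkcond (bigD1 u) //= linear_char_idem eqxx.
rewrite big1 ?addr0 => [|v nv]; first by case: (P u).
by rewrite linear_char_idem eq_sym (negPf nv) if_same.
Qed.

Lemma star_char_idem_sum (P : pred V) :
  star (\sum_(u | P u) E u) = \sum_(u | P u) E u.
Proof. by rewrite star_sum; apply: eq_bigr => u _; apply: star_char_idem. Qed.

Lemma mul_char_idem_sum p (P : pred V) :
  (forall u, P u -> chi u p = 1) ->
  p * (\sum_(u | P u) E u) = \sum_(u | P u) E u.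
Proof.
move=> pP; rewrite mulr_sumr; apply: eq_bigr => u Pu.
by rewrite mul_char_idem pP // scale1r.
Qed.

(** A character maps a projection to [0] or [1], and [star z * z] to a
    nonnegative number; conversely, for a subprojection [f] of [p] the
    difference [p - f] is a projection. *)
Lemma dominates_char_idem_sum (p : A) (P : pred V) : projection p ->
  dominates p (\sum_(u | P u) E u) <-> (forall u, P u -> chi u p = 1).
Proof.
move=> [pp ps]; split=> [[z zE] u Pu|pP].
  have [//|ne1] := eqVneq (chi u p) 1.
  have := congr1 (chi u) zE; rewrite linear_charM linear_char_star.
  rewrite linearB /= linear_char_idem_sum Pu linear_char_idempotent // (negPf ne1).
  move=> zz; have := mul_conjC_ge0 (chi u z); rewrite mulrC -zz sub0r oppr_ge0.
  by rewrite lern0.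
have pf := mul_char_idem_sum pP; have ff := char_idem_sum_mul P.
have fs := star_char_idem_sum P; set f := \sum_(u | P u) E u in pf ff fs *.
have fp : f * p = f by rewrite -[LHS]starK starM fs ps pf.
exists (p - f); rewrite -scaleN1r starD starZ fs ps rmorphN1 !scaleN1r.
by rewrite mulrBl !mulrBr pp pf fp ff subrr subr0.
Qed.
End LinearCharacters.

(** * Coideal subalgebras of [KD(n)] *)

Section KDCoideals.
Variables (C : numClosedFieldType) (n : nat).
Local Notation D := ('D_(4 * n)%N)%type.
Local Notation V := (bool * bool)%type.
Hypothesis n_gt0 : (0 < n)%N.
Variables a b : D.
Hypothesis ab_gens : dihedral_gens a b.
Local Notation E := (char_idem C a b).
Local Notation chi := (@linear_char C n a b).
Local Notation e := (KD_e C a b).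
Implicit Types (I : {vspace KD C n}) (P : pred V).

(** The exponents of [-1] at [a] and [b] in the character of [KD_e i]. *)
Definition KD_sign (i : nat) : V :=
  match i with 2 => (false, true) | 3 => (true, true) | 4 => (true, false)
  | _ => (false, false) end.

Lemma KD_eE i : (1 <= i <= 4)%N -> e i = E (KD_sign i).
Proof.
case: i => [|[|[|[|[|i]]]]]; [by []| | | | |by []] => _.
all: rewrite char_idem_sumE; congr (_ *: _); apply: eq_bigr => k _ /=.
all: by rewrite ?mul0n ?mul1n ?expr0 ?expr1 ?scaleN1r ?scale1r.
Qed.

Lemma KD_e_sum4 : e 1 + e 2 + e 3 + e 4 = \sum_(u | xpredT u) E u.
Proof.
rewrite (KD_eE (i := 1)) // (KD_eE (i := 2)) // (KD_eE (i := 3)) //.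
rewrite (KD_eE (i := 4)) // big_klein.
have addACr (x y z t : galg C D) : x + y + z + t = x + y + (t + z).
  by rewrite -addrA [z + t]addrC.
exact: addACr.
Qed.

Definition KD_pair (i : nat) : pred V := fun u => (u == 0) || (u == KD_sign i).

Lemma KD_e_sum2 i : (2 <= i <= 4)%N -> e 1 + e i = \sum_(u | KD_pair i u) E u.
Proof.
move=> i24; have i14 : (1 <= i <= 4)%N by case/andP: i24 => /ltnW -> ->.
rewrite (KD_eE i14) (KD_eE (i := 1)) //.
rewrite big_mkcond big_klein.
case: i i24 {i14} => [|[|[|[|[|i]]]]]; [by []|by []| | | |by []] => _.
all: by rewrite /KD_pair /= ?addr0 ?add0r.
Qed.

Variable I : {vspace KD C n}.
Hypothesis cI : coideal_subalgebra (KD_coprod a b) I.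
Local Notation p := (jones_proj I).

Let kac := KD_coprod_kac C ab_gens.

Let projp : projection p.
Proof. by case: (jones_projP cI). Qed.

(** Left multiplication by [p] is an idempotent of rank and trace [4n h(p)],
    while [h(p) \dim I = 1]. *)
Lemma KD_rank_jones : exists2 r : nat, (r * \dim I = 4 * n)%N &
  (4 * n)%N%:R * p 1%g = r%:R :> C.
Proof.
have [r rE] := haar_idempotent (proj1 projp); rewrite (card_D4n n_gt0) in rE.
exists r => //; apply/eqP; rewrite -(eqr_nat C) natrM -rE -mulrA.
by rewrite (haar_jones_dim kac cI) mulr1.
Qed.

Lemma KD_dim_coideal : (\dim I %| 4 * n)%N.
Proof. by have [r rE _] := KD_rank_jones; apply/dvdnP; exists r. Qed.

Lemma KD_chi0 : chi 0 p = 1.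
Proof. by rewrite linear_char0 // (counit_jones cI). Qed.

(** The rank [4n / \dim I] of [p] is even, and it has the parity of the number
    of characters that do not vanish at [p]. *)
Lemma KD_jones_parity : (\dim I %| 2 * n)%N ->
  ~~ odd (\sum_u (chi u p == 1%R)).
Proof.
have [r rE hE] := KD_rank_jones; case/dvdnP=> q qE.
have [s] := haar_idempotent_mod2 n_gt0 ab_gens (proj1 projp).
rewrite hE => /eqP; rewrite eqr_nat => /eqP sE.
have d0 : (0 < \dim I)%N.
  by rewrite lt0n; apply: contraTneq n_gt0 => d0; move: rE; rewrite d0; lia.
have : r = (2 * q)%N by apply/eqP; rewrite -(eqn_pmul2r d0); lia.
by rewrite sE; lia.
Qed.

Lemma KD_coideal_sub P : P 0 -> (forall u, P u -> chi u p = 1) ->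
  (I <= coideal_gen (KD_coprod a b) (\sum_(u | P u) E u)%R)%VS.
Proof.
move=> P0 pP; apply: (subv_coideal_gen kac cI).
  by rewrite -(linear_char0 n_gt0 ab_gens) linear_char_idem_sum // P0.
exact: mul_char_idem_sum.
Qed.

Lemma KD_dominates_pair i : (2 <= i <= 4)%N ->
  dominates p (e 1 + e i) <-> chi (KD_sign i) p = 1.
Proof.
move=> i24; rewrite KD_e_sum2 // dominates_char_idem_sum //; split=> [-> //|pi u].
  by rewrite /KD_pair eqxx orbT.
by case/orP=> /eqP ->; rewrite ?KD_chi0.
Qed.

Lemma KD_coideal_dichotomy : (\dim I %| 2 * n)%N ->
  (dominates p (e 1 + e 2 + e 3 + e 4) /\ (I <= KD_K C a b 1)%VS) \/
  exists2 i : nat,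
    unique (fun j : nat => (2 <= j <= 4)%N /\ dominates p (e 1 + e j)) i
    & (I <= KD_K C a b i)%VS.
Proof.
move/KD_jones_parity; rewrite big_klein -[(false, false)]/(0 : V) KD_chi0 eqxx.
have [|nall] := boolP [forall u, chi u p == 1].
  move=> /forallP pall _; left; rewrite /KD_K /= KD_e_sum4.
  split; first by apply/dominates_char_idem_sum => // u _; apply/eqP.
  by apply: KD_coideal_sub => // u _; apply/eqP.
move=> even3; right.
have [i i24 [/eqP pi uniq_i]] : exists2 i, (2 <= i <= 4)%N &
    chi (KD_sign i) p == 1 /\
    forall j, (2 <= j <= 4)%N -> chi (KD_sign j) p == 1 -> i = j.
  have {}nall : ~~ [&& chi (false, true) p == 1, chi (true, true) p == 1
                     & chi (true, false) p == 1].
    apply: contra nall => /and3P[p2 p3 p4]; apply/forallP=> -[[] []] //.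
    by rewrite -[(false, false)]/(0 : V) KD_chi0.
  move: nall even3.
  case p2: (chi (false, true) p == 1); case p3: (chi (true, true) p == 1);
    case p4: (chi (true, false) p == 1) => //= _ _.
  - by exists 2%N => //=; split=> // -[|[|[|[|[|j]]]]] //=; rewrite ?p3 ?p4.
  - by exists 3%N => //=; split=> // -[|[|[|[|[|j]]]]] //=; rewrite ?p2 ?p4.
  - by exists 4%N => //=; split=> // -[|[|[|[|[|j]]]]] //=; rewrite ?p2 ?p3.
exists i.
  split; first by split=> //; apply/KD_dominates_pair.
  by move=> j [j24 /(KD_dominates_pair j24)/eqP]; apply: uniq_i.
rewrite /KD_K ifN ?KD_e_sum2 //; last by case: (i) i24 => [|[]].
apply: KD_coideal_sub; first by rewrite /KD_pair eqxx.
by move=> u /orP[]/eqP->; [apply: KD_chi0|].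
Qed.

Lemma KD_coideal_pow2 m : n = (2 ^ m)%N -> I <> fullv ->
  (\dim I %| 2 * n)%N.
Proof.
move=> nE nfull.
have nE2 : (2 * n = 2 ^ m.+1)%N by rewrite expnS -nE.
have nE4 : (4 * n = 2 ^ m.+2)%N by rewrite expnS -nE2 mulnA.
have /(dvdn_pfactor _ _ (isT : prime 2))[k km dE] : (\dim I %| 2 ^ m.+2)%N.
  by rewrite -nE4; apply: KD_dim_coideal.
rewrite nE2 dE dvdn_Pexp2l // -ltnS ltn_neqAle km andbT.
apply/eqP => kE; apply: nfull; apply/eqP; rewrite eqEdim subvf dE kE -nE4.
by rewrite dimvf /dim /= muln1 (card_D4n n_gt0).
Qed.
End KDCoideals.

Unset Implicit Arguments.

Theorem proposition5p10 (R : realType) (n : nat) (n_gt0 : (0 < n)%N)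
    (a b : ('D_(4 * n)%N)%type) (ab_gens : dihedral_gens a b) :
  (forall I : {vspace KD R[i] n},
     coideal_subalgebra (KD_coprod a b) I ->
     (\dim I %| 2 * n)%N ->
     (dominates (jones_proj I)
        (KD_e R[i] a b 1 + KD_e R[i] a b 2 + KD_e R[i] a b 3 + KD_e R[i] a b 4) /\
      (I <= KD_K R[i] a b 1)%VS) \/
     exists2 i : nat,
       unique (fun j : nat => (2 <= j <= 4)%N /\
                 dominates (jones_proj I) (KD_e R[i] a b 1 + KD_e R[i] a b j)) i
       & (I <= KD_K R[i] a b i)%VS) /\
  ((exists m : nat, n = (2 ^ m)%N) ->
   forall I : {vspace KD R[i] n},
     coideal_subalgebra (KD_coprod a b) I -> I <> fullv ->
     exists2 i : nat, (1 <= i <= 4)%N & (I <= KD_K R[i] a b i)%VS).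
Proof.
split=> [I cI|[m nE] I cI nfull]; first exact: KD_coideal_dichotomy.
have dI := KD_coideal_pow2 n_gt0 ab_gens cI nE nfull.
have [[_ IK1]|[i [[/andP[i2 i4] _] _] IKi]] :=
  KD_coideal_dichotomy n_gt0 ab_gens cI dI; first by exists 1%N.
by exists i => //; rewrite i4 ltnW.
Qed.
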